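(* Let $\hat P$ be a finite planar poset with unique minimal element $u$, and let $P=\hat P\setminus\{u\}$ (assumed nonempty). Then $$\sum_{\hat L\in\mathcal{L}(\hat P)}\Delta^{(0)}(\hat L)=(q-q^{-1})^{cc-1}\Delta^{(0)}(P),$$ and, for $1\le k\le r-1$, $$\sum_{\hat L\in\mathcal{L}(\hat P)}\Delta^{(k)}(\hat L)=\Delta^{(k)}(P)\,(-q+q^{-1})^{cc-1}\Big(\prod_{s\in\mathrm{SC}}x_s\Big)\Big(\prod_{d\in\mathrm{DC}}x_d^{-1}\Big)\sum_{t=0}^{|\mathrm{DC}|}(-1)^te_t(x_{\mathrm{DC}})\,h_{k-t-cc}(x_{\mathrm{SC}}),$$ where $cc$ is the number of connected components of $P$, $e_t(x_{\mathrm{DC}})$ is the elementary symmetric function in the variables $\{x_d,\ d\in\mathrm{DC}\}$, and $h_{j}(x_{\mathrm{SC}})$ is the homogeneous symmetric function in the variables $\{x_s,\ s\in\mathrm{SC}\}$.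
   Context: $r$ is a positive integer, $q$ is an indeterminate, and $\{x_a\mid a\in\hat P\}$ are commuting indeterminates. A poset is planar (in the strong sense) if its Hasse diagram can be order-embedded in $\mathbb{R}\times\mathbb{R}$ without edge crossings even when extra bottom and top elements are added. $\mathcal{L}(\hat P)$ is the set of linear extensions of $\hat P$, i.e. total orders on the underlying set of $\hat P$ extending the order of $\hat P$, each regarded as a poset (a chain). $\mathrm{SC}$ is the set of minimal elements of $P$ (sharp corners). Two sharp corners are adjacent if they are not separated by another sharp corner as the boundary of $P$ is traversed, i.e. if they are consecutive in the left-to-right order of the minimal elements of $P$ in the planar embedding. If $s_1,s_2$ are adjacent sharp corners and their least common upper bound (join) $s_1\vee s_2$ exists in $P$, then $s_1\vee s_2$ is called a dull corner; $\mathrm{DC}$ is the collection of dull corners, one for each such adjacent pair (so counted with multiplicity if two adjacent pairs have the same join; thus $cc=|\mathrm{SC}|-|\mathrm{DC}|$). Connected components of $P$ are those of its Hasse diagram. For a poset $Q$ the Möbius function is $\mu_Q(a,a)=1$, $\mu_Q(a,b)=-\sum_{a\le x<b}\mu_Q(a,x)$ if $a<b$, and $\mu_Q(a,b)=0$ if $a\not\le b$. Weights: $wt^{(k)}(a,b)=\dfrac{1-x_ax_b^{-1}}{q-q^{-1}}$ for $a,b\in P$, $a\neq b$, and $wt^{(k)}(u,a)=x_a^{-k}$ for $a\in P$. For $Q$ equal to $P$, or to a linear extension $\hat L$ of $\hat P$, define $\Delta^{(k)}(Q)=\prod wt^{(k)}(a,b)^{\mu_Q(a,b)}$, the product over pairs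 $a<_Qb$ in $Q$ (pairs $a\not\leq_Q b$ have Möbius exponent $0$ and contribute $1$). Conventions: $e_0=h_0=1$, $h_j=0$ for $j<0$. *)

(* Defs.v *)
From HB Require Import structures.
From mathcomp Require Import all_boot all_order all_algebra.
From mathcomp Require Import reals.
From mathcomp Require Import mpoly.

Set Implicit Arguments.
Unset Strict Implicit.
Unset Printing Implicit Defensive.

Import Order.TTheory GRing.Theory Num.Theory.
Local Open Scope ring_scope.

(* A finite poset is given by a relation [le] and a carrier [A], so that the
   same definitions serve for P, for \hat P and for its linear extensions. *)
Section FinitePosets.
Variables (T : finType) (le : rel T) (A : {set T}).

Definition plt : rel T := fun a b => (a != b) && le a b.

Definition minimals : {set T} := [set s in A | [forall a in A, ~~ plt a s]].

(* The fuel [n] bounds the recursion depth; see [mobiusE]. *)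
Fixpoint mobius_rec (n : nat) (a b : T) : int :=
  if n is n'.+1 then
    if a == b then 1
    else if le a b then
      - \sum_(x in A | le a x && plt x b) mobius_rec n' a x
    else 0
  else 0.

Definition mobius (a b : T) : int := mobius_rec #|A| a b.

Definition pcovers : rel T := fun a b =>
  [&& a \in A, b \in A, plt a b & [forall c in A, ~~ (plt a c && plt c b)]].

Definition hasse_edge : rel T := fun a b => pcovers a b || pcovers b a.

Definition num_components : nat := n_comp hasse_edge A.

Definition is_join (a b c : T) : bool :=
  [&& c \in A, le a c, le b c
    & [forall d in A, (le a d && le b d) ==> le c d]].

Definition join_opt (a b : T) : option T := [pick c | is_join a b c].

Lemma mobius_rec_fuel (n m : nat) (a b : T) :
  antisymmetric le -> transitive le ->
  (#|[set x in A | plt x b]| < n)%N -> (#|[set x in A | plt x b]| < m)%N ->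
  mobius_rec n a b = mobius_rec m a b.
Proof.
move=> anti tr; elim: n m b => [|n IHn] [|m] b //= ltn ltm.
case: eqP => // _; case: ifP => // _; congr (- _).
apply: eq_bigr => x /and3P[xA _ xb].
have dec : (#|[set y in A | plt y x]| < #|[set y in A | plt y b]|)%N.
  apply: proper_card; apply/properP; split.
    apply/subsetP => y; rewrite !inE => /andP[-> /andP[yx leyx]] /=.
    case/andP: xb => xb lexb; rewrite /plt (tr _ _ _ leyx lexb) andbT.
    by apply: contra yx => /eqP eyb; apply/eqP/anti; rewrite leyx eyb lexb.
  by exists x; rewrite !inE ?xA ?xb // /plt eqxx.
by apply: IHn; apply: leq_trans dec _.
Qed.

Lemma mobiusE : antisymmetric le -> transitive le ->
  {in A &, forall a b, mobius a b =
    if a == b then 1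
    else if le a b then - \sum_(x in A | le a x && plt x b) mobius a x
    else 0}.
Proof.
have card_lt b : b \in A -> (#|[set x in A | plt x b]| < #|A|)%N.
  move=> bA; apply: proper_card; apply/properP; split.
    by apply/subsetP => x; rewrite !inE => /andP[].
  by exists b; rewrite // !inE /plt eqxx andbF.
move=> anti tr a b aA bA; rewrite {1}/mobius.
rewrite (@mobius_rec_fuel _ #|A|.+1) ?card_lt //=; first exact: leqW (card_lt _ bA).
Qed.

End FinitePosets.

Section LinearExtensions.
Variables (d : Order.disp_t) (T : finPOrderType d).

Definition rel_of (L : {set T * T}) : rel T := fun a b => (a, b) \in L.

Definition is_linear_extension (L : {set T * T}) : bool :=
  [&& [forall a, forall b, (a <= b)%O ==> rel_of L a b],
      [forall a, forall b, rel_of L a b || rel_of L b a],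
      [forall a, forall b, rel_of L a b && rel_of L b a ==> (a == b)]
    & [forall a, forall b, forall c,
         rel_of L a b && rel_of L b c ==> rel_of L a c]].

Definition linear_extensions : {set {set T * T}} :=
  [set L | is_linear_extension L].

End LinearExtensions.

(* T with an extra bottom and an extra top element. *)
Inductive bounded (T : Type) : Type := Bot | Elt of T | Top.
Arguments Bot {T}.
Arguments Top {T}.

Section Planarity.
Variables (d : Order.disp_t) (T : finPOrderType d) (R : realType).

Definition bounded_le (a b : bounded T) : bool :=
  match a, b with
  | Bot, _ => true
  | _, Top => true
  | Elt a, Elt b => (a <= b)%O
  | _, _ => false
  end.

Definition bounded_lt (a b : bounded T) : Prop := a <> b /\ bounded_le a b.

Definition bounded_covers (a b : bounded T) : Prop :=
  bounded_lt a b /\ forall c, ~ (bounded_lt a c /\ bounded_lt c b).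

Definition on_segment (p q z : R * R) : Prop :=
  exists2 t : R, 0 <= t <= 1 &
    z = ((1 - t) * p.1 + t * q.1, (1 - t) * p.2 + t * q.2).

Definition order_embedding (phi : bounded T -> R * R) : Prop :=
  forall a b, bounded_le a b <->
    ((phi a).1 <= (phi b).1) /\ ((phi a).2 <= (phi b).2).

(* Every vertex of the bounded poset lies on an edge, so this also prevents an
   edge from running through a vertex other than its endpoints. *)
Definition no_edge_crossings (phi : bounded T -> R * R) : Prop :=
  forall a b a' b', bounded_covers a b -> bounded_covers a' b' ->
    (a, b) <> (a', b') ->
  forall z, on_segment (phi a) (phi b) z -> on_segment (phi a') (phi b') z ->
  exists2 v, z = phi v & (v = a \/ v = b) /\ (v = a' \/ v = b').

Definition planar_embedding (phi : bounded T -> R * R) : Prop :=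
  order_embedding phi /\ no_edge_crossings phi.

(* For the componentwise order on R * R, incomparable points are ordered from
   left to right (across the upward diagonal) by their first coordinates. *)
Definition left_of (phi : bounded T -> R * R) : rel T :=
  fun a b => (phi (Elt a)).1 < (phi (Elt b)).1.

End Planarity.

Section Corners.
Variables (d : Order.disp_t) (T : finPOrderType d) (u : T) (R : realType).
Variable phi : bounded T -> R * R.

Definition deleted : {set T} := [set~ u].

Definition sharp_corners : {set T} := minimals <=%O deleted.

Definition adjacent_corners : {set T * T} :=
  [set s | [&& s.1 \in sharp_corners, s.2 \in sharp_corners,
    left_of phi s.1 s.2
  & [forall c in sharp_corners, ~~ (left_of phi s.1 c && left_of phi c s.2)]]].

(* A list, since different adjacent pairs may have the same join. *)
Definition dull_corners : seq T :=
  pmap (fun s => join_opt <=%O deleted s.1 s.2) (enum adjacent_corners).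

End Corners.

Section SymmetricFunctions.
Variable F : fieldType.

Definition elem_sym (t : nat) (s : seq F) : F :=
  (mesym (size s) F t).@[tnth (in_tuple s)].

Definition hom_sym (j : int) (s : seq F) : F :=
  if j is Posz n then
    (\sum_(m : 'X_{1..(size s) < n.+1} | mdeg m == n) 'X_[F, m]).@[tnth (in_tuple s)]
  else 0.

End SymmetricFunctions.

Section Weights.
Variables (K : fieldType) (d : Order.disp_t) (T : finPOrderType d).

(* K(q, x_a | a in T). *)
Definition ratfun : fieldType := {fraction {mpoly K[#|T|.+1]}}.

Definition qvar : ratfun := tofrac ('X_ord0 : {mpoly K[#|T|.+1]}).

Definition xvar (a : T) : ratfun :=
  tofrac ('X_(lift ord0 (enum_rank a)) : {mpoly K[#|T|.+1]}).

Definition wt (u : T) (k : nat) (a b : T) : ratfun :=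
  if a == u then xvar b ^- k
  else (1 - xvar a * (xvar b)^-1) / (qvar - qvar^-1).

Definition Delta (u : T) (k : nat) (le : rel T) (A : {set T}) : ratfun :=
  \prod_(a in A) \prod_(b in A | plt le a b) wt u k a b ^ mobius le A a b.

End Weights.

Arguments qvar K {d} T.
Arguments xvar K {d T} a.
Arguments wt K {d T} u k a b.
Arguments Delta K {d T} u k le A.

(* Main.v *)
(** Sum over the first element of a linear extension and induct on the up-sets
    S of P.  With nu_S(b) = mu(bot, b) computed in S with a new bottom, put
    G_S(z) = prod_(b in S) (x_b - z)^(nu_S(b)).  Removing a minimal s changes
    nu_S(b) by mu(s, b), so the induction step is exactly the partial fraction
    expansion of G_S at its poles x_s, s minimal in S.  This requires G_S to
    have only these poles, simple, and to vanish at infinity, which is where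
    planarity enters: crossing monotone paths show that two elements with an
    upper bound have a join, whence nu_S(b) counts the adjacent pairs of minimal
    elements with join b, minus 1 if b is minimal.  The sum for k = 0 is G_P(0)
    and the sums for k > 0 are the coefficients of G_P at infinity. *)

Require Import Defs.
From mathcomp Require Import all_boot all_order all_algebra.
From mathcomp Require Import reals.
From mathcomp Require Import mpoly.
From mathcomp Require Import ring lra zify.

Set Implicit Arguments.
Unset Strict Implicit.
Unset Printing Implicit Defensive.

Import Order.TTheory GRing.Theory Num.Theory.
Local Open Scope ring_scope.

(** * Partial fractions and symmetric functions *)

(** Put c = q - 1/q. The Möbius function of a chain is -1 on consecutive pairs and 0 on all other
    pairs a < b, so a linear extension contributes c x_b / (x_b - x_a) for each two consecutive
    elements a, b of P, and x_s^k for the first element s of P. The factor 1 / (x_s - x_a) is the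
    kernel 1 / (x_s - z) of a partial fraction at z = x_a; hence the induction remembers the last
    element a and evaluates G_S at x_a. The bottom u breaks this pattern, since its weights are
    powers and not differences. The first element s then brings no factor c x_s, and what remains is
    the sum of x_s^(k-1) times the residues of G_P: a partial fraction at z = 0 if k = 0, a divided
    difference if k > 0. All Möbius values are taken in the fixed set A = P. On an up-set S they
    agree with those of S, and fixing A makes nu_S change by a single term when s is removed. The
    power of c is |P| - 1 on the left and |P| + |DC| - |SC| in Delta(P); the quotient c^(cc-1) thus
    rests on cc = |SC| - |DC|, which also needs planarity. *)

Section DividedDifferences.
Variable F : fieldType.
Implicit Types (l : seq F) (p : {poly F}).

Lemma size_prod_subX l : (size (\prod_(w <- l) (w%:P - 'X))%R <= (size l).+1)%N.
Proof.
elim: l => [|w l IHl]; first by rewrite big_nil size_poly1.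
rewrite big_cons (leq_trans (size_polyMleq _ _)) // -opprB size_polyN.
by rewrite size_XsubC /=.
Qed.

Lemma prod_subC (P : pred F) l y :
  \prod_(w <- l | P w) (y - w) = (-1) ^+ count P l * \prod_(w <- l | P w) (w - y).
Proof.
elim: l => [|w l IH]; first by rewrite !big_nil mulr1.
by rewrite !big_cons /=; case: (P w) => //=; rewrite IH exprS; ring.
Qed.

Lemma count_neq_uniq l y : uniq l -> y \in l -> (count (fun w => w != y) l).+1 = size l.
Proof.
move=> Ul yl; have := count_predC (pred1 y) l.
by rewrite count_uniq_mem // yl add1n.
Qed.

(** A polynomial of degree below the number of nodes equals its Lagrange interpolant Q, as their
    difference has too many roots. The factors are y - z, not z - y, to match x_b - z in G_S. *)
Lemma lagrange_partial_fractions l p (z : F) :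
  uniq l -> (size p <= size l)%N -> z \notin l ->
  p.[z] / \prod_(y <- l) (y - z) =
  \sum_(y <- l) (y - z)^-1 * (p.[y] / \prod_(w <- l | w != y) (w - y)).
Proof.
move=> Ul szp zl.
pose B y : {poly F} := \prod_(w <- l | w != y) (w%:P - 'X).
have evB y t : (B y).[t] = \prod_(w <- l | w != y) (w - t).
  by rewrite horner_prod; apply: eq_bigr => w _; rewrite !hornerE.
have Bne y : \prod_(w <- l | w != y) (w - y) != 0.
  by rewrite prodf_seq_neq0; apply/allP => w _; apply/implyP; rewrite subr_eq0.
pose Q : {poly F} := \sum_(y <- l) (p.[y] / (B y).[y]) *: B y.
have szB y : y \in l -> (size (B y) <= size l)%N.
  move=> yl; rewrite /B -big_filter.
  by apply: (leq_trans (size_prod_subX _)); rewrite size_filter count_neq_uniq.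
have szQ : (size Q <= size l)%N.
  rewrite (leq_trans (size_sum _ _ _)) //; rewrite big_seq.
  by apply/bigmax_leqP_seq => y yl _; rewrite (leq_trans (size_scale_leq _ _)) ?szB.
have QE : p = Q.
  apply/eqP; rewrite -subr_eq0; apply/eqP; apply: (@roots_geq_poly_eq0 _ _ l) => //.
    apply/allP => y yl; rewrite /root hornerD hornerN /Q horner_sum (bigD1_seq y yl Ul) /=.
    rewrite hornerZ evB divfK ?Bne // big_seq_cond big1 ?addr0 ?subrr // => w /andP[wl wy].
    rewrite hornerZ [(B w).[y]]evB (_ : \prod_(_ <- _ | _) _ = 0) ?mulr0 //.
    apply/eqP; rewrite prodf_seq_eq0; apply/hasP; exists y => //.
    by rewrite eq_sym wy subrr eqxx.
  rewrite (leq_trans (size_polyD _ _)) // geq_max szp size_polyN szQ //.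
rewrite {1}QE horner_sum mulr_suml [LHS]big_seq [RHS]big_seq.
apply: eq_bigr => y yl; rewrite hornerZ evB evB [X in _ / X](bigD1_seq y) //=.
have Bz : \prod_(w <- l | w != y) (w - z) != 0.
  rewrite prodf_seq_neq0; apply/allP => w wl; apply/implyP; rewrite subr_eq0.
  by move=> _; apply: contraNneq zl => <-.
have yz : y - z != 0 by rewrite subr_eq0; apply: contraNneq zl => <-.
by field; rewrite Bne yz Bz.
Qed.

(** The divided difference of the function y^n at the nodes l. *)
Definition power_divided_difference (n : nat) l : F :=
  \sum_(y <- l) y ^+ n / \prod_(w <- l | w != y) (y - w).

Local Notation D := power_divided_difference.

(** Partial fractions of the constant 1 over the nodes l, evaluated at z = x, express the term of x
    as minus the sum of the other terms. *)
Lemma power_divided_difference0 x l : uniq (x :: l) ->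
  D 0 (x :: l) = (l == [::])%:R.
Proof.
case: l => [|a l] Ul.
  by rewrite /D big_seq1 big_cons eqxx big_nil divr1.
move: Ul; set s := a :: l; move=> /andP[xs Us].
have := @lagrange_partial_fractions s 1%:P x Us.
rewrite size_polyC oner_neq0 => /(_ isT xs) H; rewrite /D big_cons /=.
apply/eqP; rewrite addr_eq0; apply/eqP.
rewrite big_cons eqxx /=; move: H; rewrite hornerC.
have -> : \prod_(w <- s | w != x) (x - w) = \prod_(w <- s) (x - w).
  by rewrite big_seq_cond [RHS]big_seq; apply: eq_bigl => w; case: eqP => [->|]; rewrite ?andbT // (negbTE xs).
move=> H; rewrite prod_subC invfM expr0 mul1r.
have -> : (\prod_(w <- s) (w - x))^-1 = 1 / \prod_(w <- s) (w - x) by rewrite div1r.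
rewrite H mulr_sumr -sumrN [LHS]big_seq [RHS]big_seq; apply: eq_bigr => y ys.
have yx : y != x by apply: contraNneq xs => <-.
have Bne : \prod_(w <- s | w != y) (w - y) != 0.
  by rewrite prodf_seq_neq0; apply/allP => w _; apply/implyP; rewrite subr_eq0.
rewrite hornerC expr0 big_cons eq_sym yx !prod_subC.
rewrite count_predT.
rewrite -(count_neq_uniq (Us : uniq s) ys).
rewrite exprS; field.
by rewrite signr_eq0 Bne !subr_eq0 yx oppr_eq0 oner_eq0.
Qed.

(** y^(n+1) - x y^n = y^n (y - x): the new factor cancels x from the denominator when y differs from
    x, and kills the term when y = x. *)
Lemma power_divided_differenceS n x l : uniq (x :: l) ->
  D n.+1 (x :: l) = x * D n (x :: l) + D n l.
Proof.
move=> /andP[xl Ul].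
have -> : D n l = \sum_(y <- l) (y ^+ n.+1 / \prod_(w <- x :: l | w != y) (y - w)
    - x * (y ^+ n / \prod_(w <- x :: l | w != y) (y - w))).
  rewrite [LHS]big_seq [RHS]big_seq; apply: eq_bigr => y yl.
  have yx : y != x by apply: contraNneq xl => <-.
  have Bne : \prod_(w <- l | w != y) (y - w) != 0.
    by rewrite prodf_seq_neq0; apply/allP => w _; apply/implyP; rewrite subr_eq0 eq_sym.
  by rewrite big_cons eq_sym yx exprS; field; rewrite subr_eq0 yx Bne.
rewrite /D !big_cons eqxx /= big_split /= sumrN -mulr_sumr exprS; ring.
Qed.

End DividedDifferences.

Section SymmetricSums.
Variable F : fieldType.
Implicit Types (l : seq F).

(** Vieta's formula, with one sign for each reversed factor. *)
Lemma prod_subX_coef l (k : nat) : (k <= size l)%N ->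
  (\prod_(y <- l) (y%:P - 'X))`_(size l - k) = (-1) ^+ (size l - k) * elem_sym k l.
Proof.
move=> kl.
have kl1 : (k < (size l).+1)%N by [].
have := mroots_coeff (in_tuple l) (Ordinal kl1); rewrite /= => H.
have -> : \prod_(y <- l) (y%:P - 'X) = (-1)^+ size l *: \prod_(y <- l) ('X - y%:P).
  elim: l {k kl kl1 H} => [|y l IH]; first by rewrite !big_nil expr0 scale1r.
  by rewrite !big_cons IH /= exprS mulN1r scaleNr scalerAr -mulNr opprB.
have E : (-1) ^+ size l = (-1) ^+ (size l - k) * (-1) ^+ k :> F.
  by rewrite -exprD subnK.
rewrite coefZ H mulrA {1}E -(mulrA ((-1) ^+ _)) -exprD addnn -mul2n exprM.
by rewrite sqrrN expr1n expr1n mulr1.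
Qed.

Lemma prod_sub_elem_sym l (z : F) :
  \prod_(y <- l) (y - z) =
  \sum_(0 <= t < (size l).+1) (-1) ^+ (size l - t) * elem_sym t l * z ^+ (size l - t).
Proof.
have -> : \prod_(y <- l) (y - z) = (\prod_(y <- l) (y%:P - 'X)).[z].
  by rewrite horner_prod; apply: eq_bigr => y _; rewrite !hornerE.
rewrite (horner_coef_wide _ (size_prod_subX l)) -(big_mkord xpredT
  (fun i => (\prod_(y <- l) (y%:P - 'X))`_i * z ^+ i)) big_nat_rev /=.
by apply: eq_big_nat => t /andP[_ tl]; rewrite add0n subSS prod_subX_coef.
Qed.

End SymmetricSums.

Section CompleteSymmetric.
Variable F : fieldType.
Implicit Types (l : seq F).

(** The generating function of the h_n, with geometric series truncated at N so that polynomials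
    suffice. N is free so that h_n and h_(n+1) can be read off the same product. *)
Lemma hom_sym_coef (n N : nat) l : (n <= N)%N ->
  hom_sym n%:Z l = (\prod_(y <- l) \sum_(j < N.+1) (y ^+ j) *: 'X^j)`_n.
Proof.
move=> nN; pose s := size l; pose v := tnth (in_tuple l).
rewrite [in RHS](big_tnth _ _ l) bigA_distr_bigA /= coef_sum.
pose toF (m : 'X_{1..s < n.+1}) : {ffun 'I_s -> 'I_N.+1} := [ffun i => inord (m i)].
pose toM (f : {ffun 'I_s -> 'I_N.+1}) : 'X_{1..s < n.+1} :=
  insubd bm0 [multinom (f i : nat) | i < s].
have le_mdeg (m : 'X_{1..s}) i : (m i <= mdeg m)%N by rewrite mdegE (bigD1 i) //= leq_addr.
have toFK : cancel toF toM.
  move=> m; apply: val_inj; rewrite /toM /toF val_insubd.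
  have -> : [multinom ([ffun i => inord (m i)] i : 'I_N.+1) : nat | i < s] = m :> 'X_{1..s}.
    apply/mnmP => i; rewrite mnmE ffunE inordK // ltnS (leq_trans (le_mdeg m i)) //.
    by rewrite (leq_trans _ nN) // -ltnS bmdeg.
  by rewrite bmdeg.
rewrite /hom_sym rmorph_sum /= (reindex_onto toM toF) /=; last first.
  by move=> m _; apply: toFK.
rewrite [RHS](bigID (fun f : {ffun 'I_s -> 'I_N.+1} => \sum_i f i == n)%N) /=.
have term (f : {ffun 'I_s -> 'I_N.+1}) :
    (\prod_(i < s) (v i ^+ f i *: 'X^(f i)))`_n =
    if (\sum_i f i == n)%N then \prod_i v i ^+ f i else 0.
  have -> : \prod_(i < s) (v i ^+ f i *: 'X^(f i)) =
      (\prod_i v i ^+ f i) *: 'X^(\sum_i f i) :> {poly F}.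
    by rewrite scaler_prod prodrXr.
  rewrite coefZ coefXn eq_sym; case: eqP => _; by rewrite ?mulr1 ?mulr0.
rewrite [X in _ + X]big1 ?addr0; last by move=> f /negbTE nf; rewrite term nf.
have toME (f : {ffun 'I_s -> 'I_N.+1}) : (\sum_i f i == n)%N ->
    toM f = [multinom (f i : nat) | i < s] :> 'X_{1..s}.
  move=> /eqP fn; rewrite val_insubd mdegE.
  by under eq_bigr do rewrite mnmE; rewrite fn ltnSn.
apply: eq_big => [f|f /andP[/eqP dn /eqP fK]].
  apply/andP/idP => [[/eqP dn /eqP fK]|fn].
    rewrite -dn -fK mdegE; apply/eqP; apply: eq_bigr => i _; rewrite ffunE inordK.
      by rewrite fK.
    by rewrite ltnS (leq_trans (le_mdeg _ i)) // dn.
  split; first by rewrite toME // mdegE; under eq_bigr do rewrite mnmE.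
  by apply/eqP/ffunP => i; apply: val_inj; rewrite /= ffunE toME // mnmE inord_val.
rewrite mevalX term ifT.
  by apply: eq_bigr => i _; rewrite -{2}fK ffunE inordK // ltnS (leq_trans (le_mdeg _ i)) // dn.
rewrite -dn -fK mdegE; apply/eqP; apply: eq_bigr => i _; rewrite ffunE inordK.
  by rewrite fK.
by rewrite ltnS (leq_trans (le_mdeg _ i)) // dn.
Qed.

Lemma hom_sym0 l : hom_sym 0 l = 1.
Proof.
rewrite (@hom_sym_coef 0 0) //.
by rewrite big1 ?coef1 // => x _; rewrite big_ord1 expr0 scale1r.
Qed.

(** Multiplying the generating function by 1 - yX removes the variable y. For j = -1 the identity
    reads h_0 = h_0, and below that all terms are 0. *)
Lemma hom_sym_cons (j : int) y l :
  hom_sym (j + 1) (y :: l) = y * hom_sym j (y :: l) + hom_sym (j + 1) l.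
Proof.
case: j => [n|[|n]].
- have -> : n%:Z + 1 = n.+1%:Z by rewrite -addn1 PoszD.
  rewrite !(@hom_sym_coef _ n.+1) // !big_cons.
  set Q := \sum_(j < _) _; set G := \prod_(_ <- l) _.
  (* The error of the truncation has degree n+2, invisible in the coefficient of degree n+1. *)
  have QE : (1 - y *: 'X) * Q = 1 - (y ^+ n.+2) *: 'X^(n.+2).
    rewrite -exprZn -[RHS]opprB subrX1 -mulNr opprB; congr (_ * _).
    by apply: eq_bigr => i _; rewrite exprZn.
  have : ((1 - y *: 'X) * Q * G)`_n.+1 = G`_n.+1.
    rewrite QE mulrBl mul1r coefB -scalerAl coefZ coefXnM ltnSn mulr0.
    by rewrite subr0.
  rewrite -mulrA mulrBl mul1r coefB -scalerAl coefZ coefXM /= => <-.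
  by rewrite addrC subrK.
- have -> : Negz 0 + 1 = 0 by [].
  by rewrite !hom_sym0 mulr0 add0r.
- have -> : Negz n.+1 + 1 = Negz n by lia.
  by rewrite /= mulr0 addr0.
Qed.

Lemma hom_sym_nil (n : nat) : hom_sym n.+1%:Z [::] = 0 :> F.
Proof. by rewrite (@hom_sym_coef _ n.+1) // big_nil coef1. Qed.

(** Both sides satisfy the same recursion in n and l. At the boundary, n = 0 gives a negative degree
    as soon as there are two nodes, and no nodes give a positive degree in no variables. *)
Lemma power_divided_differenceE (n : nat) l : uniq l ->
  power_divided_difference n l = hom_sym (n%:Z - (size l)%:Z + 1) l.
Proof.
elim: l n => [|x l IHl] n Ul.
  by rewrite /power_divided_difference big_nil subr0 -PoszD addn1 hom_sym_nil.
have [_ Ul'] := andP Ul.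
elim: n => [|n IHn].
  rewrite power_divided_difference0 //; case: l {IHl Ul Ul'} => [|y l].
    by rewrite hom_sym0.
  by have -> : 0%:Z - (size (x :: y :: l))%:Z + 1 = Negz (size l) by rewrite /=; lia.
rewrite power_divided_differenceS // IHn IHl //.
have -> : n.+1%:Z - (size (x :: l))%:Z + 1 = (n%:Z - (size (x :: l))%:Z + 1) + 1.
  by rewrite /=; lia.
by rewrite [RHS]hom_sym_cons; congr (_ + hom_sym _ _); rewrite /=; lia.
Qed.

End CompleteSymmetric.

Section InterpolationSums.
Variable F : fieldType.

(** Expanding the numerator by the e_t turns the sum into divided differences of y^(k + |lD| - t),
    hence into h of degree k + |lD| - t - |lS| + 1 = k + 1 - t - cc. The |lS| - 1 reversed factors
    and the sign (-1)^(|lD| - t) of the expansion leave (-1)^(cc - 1 + t). *)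
Lemma sum_powers_partial_fractions (lD lS : seq F) (k cc : nat) :
  uniq lS -> size lS = (cc + size lD)%N -> (0 < cc)%N ->
  \sum_(y <- lS) y ^+ k * (\prod_(c <- lD) (c - y) / \prod_(w <- lS | w != y) (w - y)) =
  (-1) ^+ (cc - 1) * \sum_(0 <= t < (size lD).+1)
    (-1) ^+ t * elem_sym t lD * hom_sym (k.+1%:Z - t%:Z - cc%:Z) lS.
Proof.
move=> US szS cc0.
have step y : y \in lS ->
    y ^+ k * (\prod_(c <- lD) (c - y) / \prod_(w <- lS | w != y) (w - y)) =
    \sum_(0 <= t < (size lD).+1) (-1) ^+ (cc - 1) * ((-1) ^+ t * elem_sym t lD *
      (y ^+ (k + (size lD - t)) / \prod_(w <- lS | w != y) (y - w))).
  move=> yS; rewrite prod_sub_elem_sym mulrA mulr_sumr mulr_suml.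
  apply: eq_big_nat => t /andP[_]; rewrite ltnS => tD.
  have Bne : \prod_(w <- lS | w != y) (w - y) != 0.
    by rewrite prodf_seq_neq0; apply/allP => w _; apply/implyP; rewrite subr_eq0.
  have sz := count_neq_uniq US yS; rewrite prod_subC.
  have -> : count (fun w => w != y) lS = ((cc - 1) + (size lD - t) + t)%N by lia.
  rewrite -[in LHS](invr_sign F (size lD - t)) !exprD.
  have nz n : (-1) ^+ n != 0 :> F by rewrite signr_eq0.
  move: ((-1) ^+ (cc - 1)) ((-1) ^+ (size lD - t)) ((-1) ^+ t) (nz (cc - 1)%N)
    (nz (size lD - t)%N) (nz t) => a e b a0 e0 b0.
  by field; rewrite Bne a0 e0 b0.
rewrite big_seq (eq_bigr _ step) -big_seq exchange_big /= mulr_sumr.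
apply: eq_big_nat => t /andP[_]; rewrite ltnS => tD.
rewrite -!mulr_sumr -/(power_divided_difference _ lS) power_divided_differenceE //.
by congr (_ * (_ * hom_sym _ _)); rewrite szS; lia.
Qed.
End InterpolationSums.

(** * Joins in a planar poset *)

Section HeightParametrization.
Variable R : realType.
Implicit Types (p q : R * R) (t s : R).

(** Strictly increasing along the order, so each edge, and each upward path, is the graph of a
    function of the height. *)
Definition height p : R := p.1 + p.2.

(* First coordinate of the point of height [t] on the line through [p], [q]. *)
Definition abscissa p q t : R :=
  p.1 + (t - height p) / (height q - height p) * (q.1 - p.1).

Lemma abscissa_affine p q t s m :
  abscissa p q (t + m * (s - t)) =
  abscissa p q t + m * (abscissa p q s - abscissa p q t).
Proof. rewrite /abscissa; ring. Qed.

Lemma abscissa_left p q : abscissa p q (height p) = p.1.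
Proof. by rewrite /abscissa subrr !mul0r addr0. Qed.

Lemma abscissa_right p q : height p < height q -> abscissa p q (height q) = q.1.
Proof.
move=> pq; rewrite /abscissa divff ?mul1r ?subrKC //.
by rewrite subr_eq0 gt_eqF.
Qed.

Lemma on_segment_abscissa p q t :
  height p < height q -> height p <= t <= height q ->
  on_segment p q (abscissa p q t, t - abscissa p q t).
Proof.
move=> pq /andP[pt tq]; have pq' : 0 < height q - height p by rewrite subr_gt0.
exists ((t - height p) / (height q - height p)).
  rewrite divr_ge0 ?subr_ge0 ?(ltW pq) //=.
  by rewrite ler_pdivrMr // mul1r lerD2r.
rewrite /abscissa; move: pq'; rewrite /height => /lt0r_neq0 nz.
by congr (_, _); field.
Qed.

Lemma abscissa_bounds p q t : p.1 <= q.1 -> p.2 <= q.2 ->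
  height p < height q -> height p <= t <= height q ->
  [/\ p.1 <= abscissa p q t, abscissa p q t <= q.1,
      p.2 <= t - abscissa p q t & t - abscissa p q t <= q.2].
Proof.
move=> le1 le2 pq tpq.
have [l /andP[l0 l1] [-> ->]] := on_segment_abscissa pq tpq.
by split; nra.
Qed.

Lemma segments_cross p q p' q' t s :
  height p < height q -> height p' < height q' -> t <= s ->
  height p <= t -> s <= height q -> height p' <= t -> s <= height q' ->
  abscissa p q t < abscissa p' q' t -> abscissa p' q' s <= abscissa p q s ->
  exists2 z, on_segment p q z & on_segment p' q' z.
Proof.
move=> pq pq' ts pt sq pt' sq' ltt lts.
pose D0 := abscissa p' q' t - abscissa p q t.
pose D1 := abscissa p q s - abscissa p' q' s.
have D0p : 0 < D0 by rewrite subr_gt0.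
have D1p : 0 <= D1 by rewrite subr_ge0.
have Dp : 0 < D0 + D1 by rewrite ltr_wpDr.
(* The zero of the difference of the two abscissas, which is affine with value D0 at height t and
   -D1 at height s. *)
pose m := D0 / (D0 + D1).
have m0 : 0 <= m by rewrite divr_ge0 // ltW.
have m1 : m <= 1 by rewrite ler_pdivrMr // mul1r lerDl.
pose h := t + m * (s - t).
have th : t <= h by rewrite lerDl mulr_ge0 // subr_ge0.
have hs : h <= s by rewrite /h; nra.
have E : abscissa p q h = abscissa p' q' h.
  rewrite !abscissa_affine; apply/eqP; rewrite -subr_eq0; apply/eqP.
  transitivity (m * (D0 + D1) - D0); first by rewrite /D0 /D1; ring.
  by rewrite /m divfK ?subrr // gt_eqF.
exists (abscissa p q h, h - abscissa p q h).
  by apply: on_segment_abscissa; rewrite // (le_trans pt th) (le_trans hs sq).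
by rewrite E; apply: on_segment_abscissa; rewrite // (le_trans pt' th) (le_trans hs sq').
Qed.

Lemma height_sub_lt p (X y : R) : height p - X <= y -> y < p.2 -> p.1 < X.
Proof. by rewrite /height => *; lra. Qed.

Lemma height_sub_gt p (X y : R) : y <= height p - X -> p.2 < y -> X < p.1.
Proof. by rewrite /height => *; lra. Qed.

End HeightParametrization.

Section PlanarJoin.
Variables (d : Order.disp_t) (T : finPOrderType d) (R : realType).
Variable phi : bounded T -> R * R.
Hypothesis planar : planar_embedding phi.
Let f (a : T) : R * R := phi (Elt a).

Lemma embedding_leE a b : (a <= b)%O = ((f a).1 <= (f b).1) && ((f a).2 <= (f b).2).
Proof.
have [E _] := planar; have [H1 H2] := E (Elt a) (Elt b).
by apply/idP/andP => [/H1[]|/H2].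
Qed.

Lemma height_lt a b : (a < b)%O -> height (f a) < height (f b).
Proof.
rewrite lt_leAnge !embedding_leE => /andP[/andP[h1 h2]].
rewrite /height; case: (leP (f b).1 (f a).1) => /= h3.
  by rewrite -ltNge => h4; rewrite ler_ltD.
by move=> _; rewrite ltr_leD.
Qed.

Lemma left_of_total a b : ~~ (a >=< b)%O ->
  left_of phi a b /\ (f b).2 < (f a).2 \/ left_of phi b a /\ (f a).2 < (f b).2.
Proof.
rewrite /Order.comparable negb_or !embedding_leE !negb_and -!ltNge /left_of -/(f _) -/(f _).
move=> /andP[/orP[] h1 /orP[] h2]; [|right|left|]; rewrite ?h1 ?h2 //.
  by have := lt_trans h1 h2; rewrite ltxx.
by have := lt_trans h1 h2; rewrite ltxx.
Qed.

Definition ocovers (a b : T) := (a < b)%O && [forall c, ~~ ((a < c)%O && (c < b)%O)].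

Lemma exists_ocover a c : (a < c)%O -> exists2 b, ocovers a b & (b <= c)%O.
Proof.
move=> ac.
have P0 : (a < c <= c)%O by rewrite ac lexx.
case: (@arg_minnP _ c (fun b => a < b <= c)%O (fun b => #|[set z | (z < b)%O]|) P0) => b /andP[ab bc] Hmin.
exists b => //; rewrite /ocovers ab; apply/forallP => z; apply/negP => /andP[az zb].
have := Hmin z; rewrite az (le_trans (ltW zb) bc) => /(_ isT); apply/negP; rewrite -ltnNge.
apply: proper_card; apply/properP; split.
  by apply/subsetP => y; rewrite !inE => /lt_trans; apply.
by exists z; rewrite !inE ?zb ?ltxx.
Qed.

Lemma ocovers_bounded a b : ocovers a b -> bounded_covers (Elt a) (Elt b).
Proof.
case/andP=> ab /forallP H; split.
  by split; [case=> E; rewrite E ltxx in ab|rewrite /= ltW].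
case=> [|c|] [] [ne1 le1] [ne2 le2] //=.
have := H c; rewrite !lt_neqAle; move: le1 le2 => /= -> ->; rewrite !andbT.
case: eqP => [E|_]; first by case: ne1; rewrite E.
by case: eqP => [E|_] //; case: ne2; rewrite E.
Qed.

(** Distinct edges can meet only at a common endpoint, which serves as y; for equal edges the lower
    end does. *)
Lemma crossing_covers v v' w w' z : ocovers v v' -> ocovers w w' ->
  on_segment (f v) (f v') z -> on_segment (f w) (f w') z ->
  exists y, [/\ (v <= y)%O, (w <= y)%O, (y <= v')%O & (y <= w')%O].
Proof.
move=> cv cw zv zw; have [_ nc] := planar.
have [lv _] := andP cv; have [lw _] := andP cw.
case: (eqVneq (v, v') (w, w')) => [[<- <-]|ne].
  by exists v; rewrite lexx ltW.
have ne' : (Elt v, Elt v') <> (Elt w, Elt w').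
  by case=> E1 E2; rewrite E1 E2 eqxx in ne.
have [y _ [Hv Hw]] := nc _ _ _ _ (ocovers_bounded cv) (ocovers_bounded cw) ne' z zv zw.
case: Hv => E1; case: Hw; rewrite E1 => -[E2]; [exists v|exists v|exists v'|exists v'];
  by rewrite E2 in lv *; rewrite lexx ltW // ltW.
Qed.

Variables a b c1 c2 : T.
Hypotheses (ac1 : (a <= c1)%O) (ac2 : (a <= c2)%O) (bc1 : (b <= c1)%O) (bc2 : (b <= c2)%O).
Hypotheses (x12 : (f c1).1 < (f c2).1) (y12 : (f c2).2 < (f c1).2).
Hypotheses (xab : (f a).1 < (f b).1) (yab : (f b).2 < (f a).2).

Lemma cover_bounds v v' : ocovers v v' ->
  [/\ (f v).1 <= (f v').1, (f v).2 <= (f v').2 & height (f v) < height (f v')].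
Proof.
case/andP => /[dup] /height_lt h lv _; move: (ltW lv); rewrite embedding_leE.
by case/andP.
Qed.

Let meeting_point := exists y, [/\ (a <= y)%O, (b <= y)%O, (y <= c1)%O & (y <= c2)%O].

(* At height [t] the path from [a] to [c2], currently on the edge [v v'], is to
   the left of the path from [b] to [c1], on [w w']; it must end to its right. *)
Lemma sweep n (v v' w w' : T) t :
  (#|[set z | (v <= z)%O]| + #|[set z | (w <= z)%O]| < n)%N ->
  ocovers v v' -> ocovers w w' ->
  (a <= v)%O -> (v' <= c2)%O -> (b <= w)%O -> (w' <= c1)%O ->
  height (f v) <= t <= height (f v') -> height (f w) <= t <= height (f w') ->
  abscissa (f v) (f v') t < abscissa (f w) (f w') t -> meeting_point.
Proof.
elim: n v v' w w' t => // n IH v v' w w' t ltn cv cw av vc bw wc /andP[vt tv] /andP[wt tw] ltt.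
have [v1 v2 vh] := cover_bounds cv; have [w1 w2 wh] := cover_bounds cw.
have := vc; rewrite embedding_leE => /andP[vc1 vc2].
have := wc; rewrite embedding_leE => /andP[wc1 wc2].
have card_lt (y y' : T) : (y < y')%O -> (#|[set z | (y' <= z)%O]| < #|[set z | (y <= z)%O]|)%N.
  move=> yy; apply: proper_card; apply/properP; split.
    by apply/subsetP => z; rewrite !inE; apply: le_trans (ltW yy).
  by exists y; rewrite !inE ?lexx // lt_geF.
have cross s : t <= s -> s <= height (f v') -> s <= height (f w') ->
    abscissa (f w) (f w') s <= abscissa (f v) (f v') s -> meeting_point.
  move=> ts sv sw les.
  have [z zv zw] := segments_cross vh wh ts vt sv wt sw ltt les.
  have [y [vy wy yv yw]] := crossing_covers cv cw zv zw.
  by exists y; split; [exact: le_trans vy|exact: le_trans wy|exact: le_trans yw _|exact: le_trans yv _].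
(* The sweep rises to the lower of the two upper ends. If the horizontal order is reversed there,
   the edges cross; otherwise the path whose edge ends there moves to its next edge, and the up-set
   of its current vertex shrinks. *)
case: (leP (height (f v')) (height (f w'))) => hh.
- case: (leP (abscissa (f w) (f w') (height (f v'))) (abscissa (f v) (f v') (height (f v')))).
    by apply: cross.
  rewrite abscissa_right // => lts.
  have [_ Bx _ By] := abscissa_bounds w1 w2 wh (introT andP (conj (le_trans wt tv) hh)).
  (* The path from a cannot end here: c2 would lie to the left of a point of w w', whose abscissa is
     at most that of c1. *)
  case: (eqVneq v' c2) => [E|ne].
    by have := lt_trans (lt_le_trans lts (le_trans Bx wc1)) x12; rewrite E ltxx.
  have vc' : (v' < c2)%O by rewrite lt_neqAle ne.
  have [v'' cv' vc''] := exists_ocover vc'.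
  have [lv' _] := andP cv'; have [lv _] := andP cv.
  apply: (IH v' v'' w w' (height (f v'))) => //.
  + by move: ltn; rewrite ltnS; apply: leq_trans; rewrite -addSn leq_add2r card_lt.
  + exact: le_trans av (ltW lv).
  + by rewrite lexx ltW // height_lt.
  + by rewrite hh (le_trans wt tv).
  + by rewrite abscissa_left.
- case: (leP (abscissa (f w) (f w') (height (f w'))) (abscissa (f v) (f v') (height (f w')))).
    by apply: cross => //; exact: ltW.
  rewrite (abscissa_right wh) => lts.
  have [_ Ax _ Ay] := abscissa_bounds v1 v2 vh (introT andP (conj (le_trans vt tw) (ltW hh))).
  (* Likewise for c1: the point of v v' at the height of c1 has second coordinate at most that of
     c2, below that of c1, so it would lie to the right of c1. *)
  case: (eqVneq w' c1) => [E|ne].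
    rewrite E in Ay lts; have y21 := le_lt_trans vc2 y12.
    by have := lt_trans (height_sub_lt Ay y21) lts; rewrite ltxx.
  have wc' : (w' < c1)%O by rewrite lt_neqAle ne.
  have [w'' cw' wc''] := exists_ocover wc'.
  have [lw' _] := andP cw'; have [lw _] := andP cw.
  apply: (IH v v' w' w'' (height (f w'))) => //.
  + by move: ltn; rewrite ltnS; apply: leq_trans; rewrite -addnS leq_add2l card_lt.
  + exact: le_trans bw (ltW lw).
  + by rewrite (ltW hh) (le_trans vt tw).
  + by rewrite lexx ltW // height_lt.
  + by rewrite abscissa_left.
Qed.

Lemma cover_at_height v c t : (v <= c)%O -> height (f v) <= t < height (f c) ->
  exists w w', [/\ ocovers w w', (v <= w)%O, (w' <= c)%O & height (f w) <= t <= height (f w')].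
Proof.
move=> vc /andP[vt tc].
have P0 : (v <= v <= c)%O && (height (f v) <= t) by rewrite lexx vc vt.
case: (@arg_minnP _ v (fun z => (v <= z <= c)%O && (height (f z) <= t))
  (fun y => #|[set z | (y <= z)%O]|) P0) => w /andP[/andP[vw wc] wt] Hmin.
have wc' : (w < c)%O.
  by rewrite lt_neqAle wc andbT; apply: contraTneq wt => ->; rewrite -ltNge.
have [w' cw w'c] := exists_ocover wc'.
exists w, w'; split => //; rewrite wt /= leNgt; apply/negP => ltw.
have [lw _] := andP cw.
have := Hmin w'; rewrite w'c (le_trans vw (ltW lw)) (ltW ltw) => /(_ isT).
apply/negP; rewrite -ltnNge; apply: proper_card; apply/properP; split.
  by apply/subsetP => z; rewrite !inE; apply: le_trans (ltW lw).
by exists w; rewrite !inE ?lexx // lt_geF.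
Qed.

(** The path from a to c2 starts on the left of the path from b to c1 and ends on its right. The
    sweep begins at the height of the higher of a and b, where the coordinates of a and b and
    monotonicity along the other path give the initial order. *)
Lemma crossing_paths_meet : meeting_point.
Proof.
have leE := embedding_leE.
have lt_b2 : (b < c2)%O.
  rewrite lt_neqAle bc2 andbT; apply: contraTneq ac2 => <-; rewrite leE.
  by rewrite [(f a).2 <= _]leNgt yab andbF.
have lt_a1 : (a < c1)%O.
  rewrite lt_neqAle ac1 andbT; apply: contraTneq bc1 => E; rewrite leE -E.
  by rewrite [(f b).1 <= _]leNgt xab.
have lt_a2 : (a < c2)%O.
  rewrite lt_neqAle ac2 andbT; apply: contraTneq bc2 => E; rewrite leE -E.
  by rewrite [(f b).1 <= _]leNgt xab.
have lt_b1 : (b < c1)%O.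
  rewrite lt_neqAle bc1 andbT; apply: contraTneq ac1 => E; rewrite leE -E.
  by rewrite [(f a).2 <= _]leNgt yab andbF.
case: (leP (height (f a)) (height (f b))) => hab.
- have [|v [v' [cv av vc tv]]] := @cover_at_height a c2 (height (f b)) ac2.
    by rewrite hab height_lt.
  have [w' cw wc] := exists_ocover lt_b1.
  apply: (@sweep _ v v' b w' (height (f b)) (ltnSn _)) => //.
    by rewrite lexx ltW // height_lt //; case/andP: cw.
  rewrite abscissa_left.
  have [v1 v2 vh] := cover_bounds cv.
  have [_ _ Ay _] := abscissa_bounds v1 v2 vh tv.
  move: av; rewrite leE => /andP[_ ay].
  exact: height_sub_gt Ay (lt_le_trans yab ay).
- have [|w [w' [cw bw wc tw]]] := @cover_at_height b c1 (height (f a)) bc1.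
    by rewrite (ltW hab) height_lt.
  have [v' cv vc] := exists_ocover lt_a2.
  apply: (@sweep _ a v' w w' (height (f a)) (ltnSn _)) => //.
    by rewrite lexx ltW // height_lt //; case/andP: cv.
  rewrite abscissa_left.
  have [w1 w2 wh] := cover_bounds cw.
  have [Bx _ _ _] := abscissa_bounds w1 w2 wh tw.
  move: bw; rewrite leE => /andP[bx _].
  exact: lt_le_trans xab (le_trans bx Bx).
Qed.

End PlanarJoin.

Section Joins.
Variables (d : Order.disp_t) (T : finPOrderType d) (R : realType).
Variable phi : bounded T -> R * R.
Hypothesis planar : planar_embedding phi.

(** An interpolation property. If both pairs are incomparable, exchanging names reduces the four
    possible horizontal orders to the one of [crossing_paths_meet]. *)
Lemma planar_meeting_point (a b c1 c2 : T) :
  (a <= c1)%O -> (a <= c2)%O -> (b <= c1)%O -> (b <= c2)%O ->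
  exists y, [/\ (a <= y)%O, (b <= y)%O, (y <= c1)%O & (y <= c2)%O].
Proof.
move=> ac1 ac2 bc1 bc2.
case: (boolP (a >=< b)%O) => [/orP[ab|ba]|nab].
- by exists b.
- by exists a.
case: (boolP (c1 >=< c2)%O) => [/orP[cc|cc]|ncc].
- by exists c1.
- by exists c2.
have [[xab yab]|[xab yab]] := left_of_total planar nab;
have [[x12 y12]|[x12 y12]] := left_of_total planar ncc.
- exact: (crossing_paths_meet planar ac1 ac2 bc1 bc2 x12 y12 xab yab).
- have [y []] := crossing_paths_meet planar ac2 ac1 bc2 bc1 x12 y12 xab yab.
  by exists y.
- have [y []] := crossing_paths_meet planar bc1 bc2 ac1 ac2 x12 y12 xab yab.
  by exists y.
- have [y []] := crossing_paths_meet planar bc2 bc1 ac2 ac1 x12 y12 xab yab.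
  by exists y.
Qed.

(** A minimal common upper bound j is least: interpolating between a, b and j, e gives an upper
    bound below both j and e, which must be j. *)
Lemma planar_least_upper_bound (a b c : T) : (a <= c)%O -> (b <= c)%O ->
  exists j, [/\ (a <= j)%O, (b <= j)%O &
    forall e, (a <= e)%O -> (b <= e)%O -> (j <= e)%O].
Proof.
move=> ac bc.
have P0 : (a <= c)%O && (b <= c)%O by rewrite ac.
case: (@arg_minnP _ c (fun z => (a <= z)%O && (b <= z)%O)
  (fun z => #|[set y | (y <= z)%O]|) P0) => j /andP[aj bj] Hmin.
exists j; split => // e ae be.
have [y [ay b_y yj ye]] := planar_meeting_point aj ae bj be.
suff <- : y = j by [].
apply/eqP; rewrite eq_le yj; apply: contraTT isT => jy.
have := Hmin y; rewrite ay b_y => /(_ isT); rewrite leqNgt => /negP[].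
apply: proper_card; apply/properP; split.
  by apply/subsetP => z; rewrite !inE => /le_trans; apply.
by exists j; rewrite !inE ?lexx.
Qed.

End Joins.

(** * Minimal elements of up-sets *)

Section Consecutive.
Variables (T : finType) (lt : rel T) (M : {set T}).
Hypotheses (lt_irr : irreflexive lt) (lt_trans : transitive lt).
Hypothesis lt_total : {in M &, forall a b, a != b -> lt a b || lt b a}.

(** The condition of [adjacent_corners] for an arbitrary set M, to be applied to the minimal
    elements of every up-set. *)
Definition consecutive : {set T * T} :=
  [set s | [&& s.1 \in M, s.2 \in M, lt s.1 s.2
             & [forall c in M, ~~ (lt s.1 c && lt c s.2)]]].

Lemma consecutiveP p m : reflect
  [/\ p \in M, m \in M, lt p m & {in M, forall c, lt p c -> lt c m -> False}]
  ((p, m) \in consecutive).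
Proof.
rewrite inE /=; apply: (iffP and4P) => -[pM mM pm H]; split => //.
  by move=> c cM pc cm; move/forall_inP: H => /(_ c cM); rewrite pc cm.
by apply/forall_inP => c cM; apply/negP => /andP[pc cm]; exact: (H c).
Qed.

Lemma exists_predecessor a m : a \in M -> m \in M -> lt a m ->
  exists2 p, (p, m) \in consecutive & (p == a) || lt a p.
Proof.
move=> aM mM am.
have P0 : [&& a \in M, lt a m & (a == a) || lt a a] by rewrite aM am eqxx.
case: (@arg_maxnP _ a (fun p => [&& p \in M, lt p m & (p == a) || lt a p])
  (fun p => #|[set z | lt z p]|) P0) => p /and3P[pM pm ap] Hmax.
exists p => //; apply/consecutiveP; split => // c cM pc cm.
have ac : lt a c by case/orP: ap => [/eqP <-|/lt_trans]; last apply.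
have := Hmax c; rewrite cM cm ac orbT => /(_ isT); rewrite /= leqNgt => /negP[].
apply: proper_card; apply/properP; split.
  by apply/subsetP => z; rewrite !inE => /lt_trans; apply.
by exists p; rewrite !inE ?lt_irr.
Qed.

Lemma consecutive_inj : {in consecutive &, injective snd}.
Proof.
move=> [p m] [p' m'] /consecutiveP[pM mM pm H] /consecutiveP[pM' _ pm' H'] /= E.
rewrite -{}E in pm' H' *; congr (_, _); apply/eqP; apply: contraT => ne.
by case/orP: (lt_total pM pM' ne) => h; [case: (H p')|case: (H' p)].
Qed.

Lemma exists_first (E : {set T}) : E \subset M -> E != set0 ->
  exists2 l, l \in E & {in E, forall c, c != l -> lt l c}.
Proof.
move=> /subsetP EM /set0Pn[e eE].
case: (@arg_minnP _ e (mem E) (fun p => #|[set z in M | lt z p]|) eE) => l lE Hmin.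
exists l => // c cE cl; have := lt_total (EM _ cE) (EM _ lE) cl.
case/orP => // lcl; have := Hmin c cE; rewrite leqNgt => /negP[].
apply: proper_card; apply/properP; split.
  by apply/subsetP => z; rewrite !inE => /andP[-> /lt_trans]; apply.
by exists c; rewrite !inE ?lt_irr ?EM ?lcl.
Qed.

(** By convexity the predecessor of an element of E other than the first is again in E, so [snd]
    maps the consecutive pairs inside E bijectively onto E without its first element. *)
Lemma card_consecutive_interval (E : {set T}) : E \subset M -> E != set0 ->
  {in E & M & E, forall a b c, lt a b -> lt b c -> b \in E} ->
  #|E| = #|[set s in consecutive | (s.1 \in E) && (s.2 \in E)]|.+1.
Proof.
move=> EM E0 conv; have [l lE lmin] := exists_first EM E0.
have sEM := subsetP EM.
rewrite (cardsD1 l E) lE add1n; congr _.+1.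
rewrite -(card_in_imset (f := snd)); last first.
  by apply: sub_in2 consecutive_inj => s; rewrite inE => /andP[].
apply/eq_card => m; rewrite !inE; apply/andP/imsetP => [[ml mE]|[[p m'] /= H ->]].
  have [p pm lp] := exists_predecessor (sEM _ lE) (sEM _ mE) (lmin _ mE ml).
  exists (p, m) => //; rewrite inE pm /= mE andbT.
  have [pM mM ltpm _] := consecutiveP _ _ pm.
  by case/orP: lp => [/eqP -> //|lp]; apply: conv lp ltpm.
move: H; rewrite inE => /and3P[/consecutiveP[pM mM pm _] /= pE mE]; split => //.
apply: contraTneq pm => E1; subst m'; apply/negP => pl.
have pnl : p != l by apply: contraTneq pl => ->; rewrite lt_irr.
by have := lt_trans pl (lmin _ pE pnl); rewrite lt_irr.
Qed.

End Consecutive.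

(** * The Möbius function of an up-set with an added bottom *)

Section MobiusSums.
Variables (d : Order.disp_t) (T : finPOrderType d) (A : {set T}).
Local Notation mu := (mobius <=%O A).
Implicit Types (S : {set T}).

Definition upset S := forall a b, a \in S -> (a <= b)%O -> b \in S.

Lemma plt_leE (a b : T) : plt <=%O a b = (a < b)%O.
Proof. by rewrite /plt lt_neqAle. Qed.

Lemma poset_mobiusE : {in A &, forall a b, mu a b =
    if a == b then 1
    else if (a <= b)%O then - \sum_(x in A | (a <= x < b)%O) mu a x else 0}.
Proof.
move=> a b aA bA; rewrite mobiusE //; [|exact: le_anti|exact: le_trans].
case: eqP => // _; case: ifP => // _; congr (- _); apply: eq_bigl => x.
by rewrite plt_leE.
Qed.

Lemma mobius_id : {in A, forall a, mu a a = 1}.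
Proof. by move=> a aA; rewrite poset_mobiusE // eqxx. Qed.

Lemma mobius_nle : {in A &, forall a b, ~~ (a <= b)%O -> mu a b = 0}.
Proof.
by move=> a b aA bA nab; rewrite poset_mobiusE // (negbTE nab); case: eqP nab => // ->; rewrite lexx.
Qed.

Lemma sum_mobius_interval : {in A &, forall a b,
  \sum_(x in A | (a <= x <= b)%O) mu a x = (a == b)%:R}.
Proof.
move=> a b aA bA; case: (boolP (a <= b)%O) => [ab|nab]; last first.
  rewrite big1 => [|x /andP[_ /andP[ax xb]]].
    by case: eqP nab => // ->; rewrite lexx.
  by rewrite (le_trans ax xb) in nab.
rewrite (bigD1 b) /=; last by rewrite bA ab lexx.
rewrite poset_mobiusE // ab; case: eqVneq => [E|ne].
  subst b; rewrite big1 ?addr0 // => x /andP[/andP[_ h] xa].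
  by rewrite eq_le andbC h in xa.
rewrite [X in _ + X](eq_bigl (fun x => (x \in A) && (a <= x < b)%O)) ?addNr //.
by move=> x; rewrite lt_neqAle; case: (x \in A); case: (_ <= _)%O; case: eqP; rewrite ?andbF ?andbT.
Qed.

(* [mu(bot, b)] for the poset obtained from [S] by adding a least element
   [bot]. *)
Definition bottom_mobius S (b : T) : int := - \sum_(a in S) mu a b.
Local Notation nu := bottom_mobius.

Section Upset.
Variable S : {set T}.
Hypotheses (SA : S \subset A) (upS : upset S).

(** The Möbius function sums to 0 over the interval from the added bottom to b, and the bottom
    itself contributes 1. *)
Lemma sum_bottom_mobius : {in S, forall b, \sum_(y in S | (y <= b)%O) nu S y = -1}.
Proof.
move=> b bS; rewrite /nu sumrN exchange_big /=; congr (- _).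
have sSA := subsetP SA.
rewrite (eq_bigr (fun a => (a == b)%:R)) => [|a aS].
  by rewrite (bigD1 b) //= eqxx big1 ?addr0 // => a /andP[_ /negbTE ->].
rewrite -(sum_mobius_interval (sSA _ aS) (sSA _ bS)).
rewrite (bigID (fun y => a <= y)%O) /= [X in _ + X]big1 ?addr0.
  apply: eq_bigl => y; case: (boolP (a <= y)%O) => ay; rewrite ?andbF //= andbT.
  by rewrite (upS aS ay) (sSA _ (upS aS ay)).
by move=> y /andP[/andP[yS _] nay]; rewrite mobius_nle ?sSA.
Qed.

(** Uniqueness in Möbius inversion: the system of lower sums is unitriangular. *)
Lemma eq_of_lower_sums (f g : T -> int) :
  {in S, forall b, \sum_(y in S | (y <= b)%O) f y = \sum_(y in S | (y <= b)%O) g y} ->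
  {in S, f =1 g}.
Proof.
move=> H b; have [n] := ubnP #|[set z | (z < b)%O]|; elim: n b => // n IH b ltn bS.
have := H b bS; rewrite (bigD1 b) ?bS ?lexx //= [RHS](bigD1 b) ?bS ?lexx //=.
have -> : \sum_(y | (y \in S) && (y <= b)%O && (y != b)) f y
        = \sum_(y | (y \in S) && (y <= b)%O && (y != b)) g y.
  apply: eq_bigr => y /andP[/andP[yS yb] ne]; apply: IH => //.
  have ltyb : (y < b)%O by rewrite lt_neqAle ne.
  rewrite (leq_trans _ (ltn : (_ <= n)%N)) //; apply: proper_card; apply/properP; split.
    by apply/subsetP => z; rewrite !inE => /lt_trans; apply.
  by exists y; rewrite !inE ?ltxx.
by move/addIr.
Qed.

Lemma bottom_mobius_setD1 s : s \in S -> forall b,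
  nu (S :\ s) b = nu S b + mu s b.
Proof.
by move=> sS b; rewrite /nu [\sum_(a in S) _](big_setD1 s) //= opprD addrC addrA subrr add0r.
Qed.

Lemma mem_minimals s : (s \in minimals <=%O S) = (s \in S) && [forall a in S, ~~ (a < s)%O].
Proof. by rewrite inE; congr (_ && _); apply: eq_forallb => a; rewrite plt_leE. Qed.

Lemma minimalsP s : reflect (s \in S /\ {in S, forall a, (a <= s)%O -> a = s})
  (s \in minimals <=%O S).
Proof.
rewrite mem_minimals; apply: (iffP andP) => -[sS H]; split => //.
  move=> a aS; rewrite le_eqVlt => /orP[/eqP //|als].
  by move/forall_inP: H => /(_ a aS); rewrite als.
apply/forall_inP => a aS; apply/negP => als.
by have := H a aS (ltW als) => E; rewrite E ltxx in als.
Qed.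

Lemma upset_setD1 s : s \in minimals <=%O S -> upset (S :\ s).
Proof.
case/minimalsP => sS Hs a b; rewrite !inE => /andP[ne aS] ab.
rewrite (upS aS ab) andbT; apply: contraNneq ne => E; rewrite E in ab.
by rewrite (Hs a).
Qed.

Lemma exists_minimal b : b \in S -> exists2 s, s \in minimals <=%O S & (s <= b)%O.
Proof.
move=> bS; have P0 : (b \in S) && (b <= b)%O by rewrite bS lexx.
case: (@arg_minnP _ b (fun z => (z \in S) && (z <= b)%O)
  (fun z => #|[set y | (y < z)%O]|) P0) => s /andP[sS sb] Hmin.
exists s => //; apply/minimalsP; split => // a aS a_s; apply/eqP; apply: contraT => ne.
have lta : (a < s)%O by rewrite lt_neqAle ne.
have := Hmin a; rewrite aS (le_trans a_s sb) => /(_ isT); rewrite leqNgt => /negP[].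
apply: proper_card; apply/properP; split.
  by apply/subsetP => z; rewrite !inE => /lt_trans; apply.
by exists a; rewrite !inE ?ltxx.
Qed.

End Upset.
End MobiusSums.

Lemma prod_expr_count (I : finType) (F : fieldType) (S : {set I}) (l : seq I) (g : I -> F) :
  {subset l <= S} -> \prod_(b in S) g b ^+ count_mem b l = \prod_(c <- l) g c.
Proof.
elim: l => [|c l IH] sl; first by rewrite big_nil big1.
have cS : c \in S by apply: sl; rewrite inE eqxx.
rewrite big_cons -IH => [|x xl]; last by apply: sl; rewrite inE xl orbT.
rewrite (bigD1 c) //= eqxx [in RHS](bigD1 c) //= exprD expr1 mulrA; congr (_ * _).
by apply: eq_bigr => b /andP[_ /negbTE]; rewrite eq_sym => ->.
Qed.

Lemma sum_count_mem (I : finType) (S : {set I}) (l : seq I) (a : pred I) :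
  {subset l <= S} -> (\sum_(b in S | a b) count_mem b l = count a l)%N.
Proof.
elim: l => [|c l IH] sl /=; first by rewrite big1.
have cS : c \in S by apply: sl; rewrite inE eqxx.
rewrite big_split /= IH => [|x xl]; last by apply: sl; rewrite inE xl orbT.
congr (_ + _)%N; case: (boolP (a c)) => ac.
  rewrite (bigD1 c) /= ?cS // eqxx big1 // => b /andP[_ /negbTE].
  by rewrite eq_sym => ->.
by rewrite big1 // => b /andP[_ ab]; case: eqP => // E; rewrite E ab in ac.
Qed.

Lemma count_pmap (I J : Type) (f : I -> option J) (a : pred J) (l : seq I) :
  count a (pmap f l) = count (fun i => oapp a false (f i)) l.
Proof. by elim: l => //= i l <-; case: (f i). Qed.

(** * Corners of up-sets in a planar poset *)

Section PlanarCorners.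
Variables (d : Order.disp_t) (T : finPOrderType d) (R : realType).
Variables (phi : bounded T -> R * R) (A : {set T}).
Hypothesis planar : planar_embedding phi.
Implicit Types (S : {set T}).

Local Notation nu := (bottom_mobius A).
Local Notation min := (minimals <=%O).
Local Notation left := (left_of phi).

Definition neighbors S := consecutive left (min S).

(** For S = A = [deleted u] this is [dull_corners]. Joins are taken in the fixed A; those of
    elements of an up-set S lie in S. *)
Definition neighbor_joins S : seq T :=
  pmap (fun s => join_opt <=%O A s.1 s.2) (enum (neighbors S)).

Lemma left_of_irr : irreflexive left.
Proof. by move=> a; rewrite /left_of ltxx. Qed.

Lemma left_of_trans : transitive left.
Proof. by move=> a b c; apply: lt_trans. Qed.

Lemma minimals_incomparable S : {in min S &, forall a b, a != b -> ~~ (a >=< b)%O}.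
Proof.
move=> a b /minimalsP[aS Ha] /minimalsP[bS Hb] ne; apply/negP => /orP[ab|ba].
  by rewrite (Hb a) ?eqxx in ne.
by rewrite (Ha b) ?eqxx in ne.
Qed.

Lemma minimals_left_total S : {in min S &, forall a b, a != b -> left a b || left b a}.
Proof.
move=> a b aM bM ne.
by have [[-> _]|[-> _]] := left_of_total planar (minimals_incomparable aM bM ne); rewrite ?orbT.
Qed.

(** Among incomparable points going right means going down: s3 bounds the first coordinate of s2 and
    s1 bounds the second. *)
Lemma minimals_below_interval S b : {in min S & &, forall s1 s2 s3,
  left s1 s2 -> left s2 s3 -> (s1 <= b)%O -> (s3 <= b)%O -> (s2 <= b)%O}.
Proof.
move=> s1 s2 s3 m1 m2 m3 l12 l23.
have n12 : s1 != s2 by apply: contraTneq l12 => ->; rewrite left_of_irr.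
rewrite !(embedding_leE planar) => /andP[_ y1] /andP[x3 _].
rewrite (le_trans (ltW l23) x3) /=; apply: le_trans y1.
have [[_ /ltW //]|[l21 _]] := left_of_total planar (minimals_incomparable m1 m2 n12).
by have := left_of_trans l12 l21; rewrite left_of_irr.
Qed.

Lemma join_opt_some (a b j : T) : (join_opt <=%O A a b == Some j) = is_join <=%O A a b j.
Proof.
rewrite /join_opt; case: pickP => [c Hc|H]; last by rewrite H.
apply/eqP/idP => [[<-] //|Hj]; congr Some; apply: le_anti.
case/and4P: Hc Hj => cA ac bc /forall_inP Hc /and4P[jA aj bj /forall_inP Hj].
have := Hc _ jA; have := Hj _ cA; rewrite aj bj ac bc /=.
by move=> -> ->.
Qed.

Lemma join_opt_bounded (a b c : T) : upset A -> a \in A -> (a <= c)%O -> (b <= c)%O ->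
  exists2 j, join_opt <=%O A a b = Some j & (j <= c)%O.
Proof.
move=> upA aA ac bc; have [j [aj bj Hj]] := planar_least_upper_bound planar ac bc.
exists j; last exact: Hj.
apply/eqP; rewrite join_opt_some /is_join aj bj (upA _ _ aA aj) /=.
by apply/forall_inP => e _; apply/implyP => /andP[ae be]; apply: Hj.
Qed.

(** Covers the absence of a join as well, since by planarity a common upper bound forces a join. *)
Lemma oapp_join_opt (a b c : T) : upset A -> a \in A ->
  oapp (fun j => (j <= c)%O) false (join_opt <=%O A a b) = (a <= c)%O && (b <= c)%O.
Proof.
move=> upA aA; apply/idP/andP => [|[ac bc]]; last first.
  by have [j -> jc] := join_opt_bounded upA aA ac bc.
case E : (join_opt _ _ _ _) => [j|] //= jc.
move/eqP: E; rewrite join_opt_some => /and4P[_ aj bj _].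
by split; apply: le_trans jc.
Qed.

Section Upset.
Variable S : {set T}.
Hypotheses (SA : S \subset A) (upA : upset A) (upS : upset S).

Lemma neighborsP p m : reflect
  [/\ p \in min S, m \in min S, left p m & {in min S, forall c, left p c -> left c m -> False}]
  ((p, m) \in neighbors S).
Proof. exact: consecutiveP. Qed.

Lemma neighbor_joinsP j : reflect
  (exists2 s, s \in neighbors S & is_join <=%O A s.1 s.2 j) (j \in neighbor_joins S).
Proof.
rewrite mem_pmap; apply: (iffP mapP) => -[s].
  rewrite mem_enum => sN E; exists s => //; by rewrite -join_opt_some -E.
by move=> sN; rewrite -join_opt_some => /eqP <-; exists s; rewrite ?mem_enum.
Qed.

Lemma neighbor_joins_sub : {subset neighbor_joins S <= S}.
Proof.
move=> j /neighbor_joinsP[[p m] /neighborsP[/minimalsP[pS _] _ _ _] /and4P[_ pj _ _]].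
exact: upS pS pj.
Qed.

Lemma neighbor_join_gt j : j \in neighbor_joins S -> j \notin min S.
Proof.
move=> /neighbor_joinsP[[p m] /neighborsP[/minimalsP[pS _] /minimalsP[mS _] pm _]].
case/and4P=> /= _ pj mj _; apply/negP => /minimalsP[_ Hj].
by move: pm; rewrite (Hj p) // (Hj m) // left_of_irr.
Qed.

(** Lower sums determine nu. The minimal elements below b form a nonempty interval E from left to
    right, so |E| - 1 adjacent pairs have a join below b, and the right side sums to (|E| - 1) - |E|
    = -1. *)
Lemma bottom_mobius_planar : {in S, forall b,
  nu S b = (count_mem b (neighbor_joins S))%:Z - (b \in min S)%:Z}.
Proof.
apply: eq_of_lower_sums => b bS; rewrite sum_bottom_mobius //.
rewrite big_split /= sumrN -!(big_morph Posz PoszD (erefl 0%:Z)).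
rewrite sum_count_mem; last exact: neighbor_joins_sub.
rewrite count_pmap.
pose E := [set m in min S | (m <= b)%O].
have inEE m : (m \in E) = (m \in min S) && (m <= b)%O by rewrite in_set.
have -> : (\sum_(i in S | (i <= b)%O) (i \in min S))%N = #|E|.
  rewrite -sum1_card big_mkcond [RHS]big_mkcond; apply: eq_bigr => m _.
  by rewrite !inE; case: (m \in S); case: (m <= b)%O; rewrite ?andbF ?andbT //=; case: ifP => [->|->].
have -> : count (fun s => oapp (fun j => (j <= b)%O) false (join_opt <=%O A s.1 s.2))
   (enum (neighbors S)) = #|[set s in neighbors S | (s.1 \in E) && (s.2 \in E)]|.
  rewrite -sum1_count big_enum_cond -sum1_card; apply: eq_bigl => -[p m].
  rewrite in_set; case: (boolP (_ \in neighbors S)) => //= /neighborsP[pM mM _ _].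
  rewrite oapp_join_opt //; first by rewrite !inEE pM mM.
  by apply: (subsetP SA); case/minimalsP: pM.
have E0 : E != set0.
  by have [s sM sb] := exists_minimal bS; apply/set0Pn; exists s; rewrite inEE sM.
have EM : E \subset min S by apply/subsetP => m; rewrite inEE => /andP[].
rewrite (card_consecutive_interval left_of_irr left_of_trans (@minimals_left_total S) EM E0).
  by rewrite -addn1 PoszD opprD addNKr.
move=> s1 s2 s3; rewrite !inEE => /andP[m1 b1] m2 /andP[m3 b3] l12 l23.
by rewrite m2; apply: (minimals_below_interval m1 m2 m3 l12 l23 b1 b3).
Qed.

Lemma card_minimals_neighbors : S != set0 -> #|min S| = #|neighbors S|.+1.
Proof.
move=> /set0Pn[b bS]; have [s sM _] := exists_minimal bS.
rewrite (card_consecutive_interval left_of_irr left_of_trans (@minimals_left_total S) (subxx _)).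
- congr _.+1; apply: eq_card => -[p m]; rewrite inE.
  case: (boolP (_ \in consecutive _ _)) => //= /neighborsP[pM mM _ _].
  by rewrite pM mM.
- by apply/set0Pn; exists s.
- by [].
Qed.

(** This makes G_S vanish at infinity, and for S = P it also gives cc > 0. *)
Lemma size_neighbor_joins : S != set0 -> (size (neighbor_joins S) < #|min S|)%N.
Proof.
move=> S0; rewrite card_minimals_neighbors // ltnS size_pmap.
by rewrite (leq_trans (count_size _ _)) // -cardE.
Qed.

Lemma prod_expz_bottom_mobius (F : fieldType) (g : T -> F) : {in S, forall b, g b != 0} ->
  \prod_(b in S) g b ^ nu S b = (\prod_(c <- neighbor_joins S) g c) / \prod_(s in min S) g s.
Proof.
move=> g0; rewrite -(prod_expr_count g neighbor_joins_sub).
have -> : \prod_(s in min S) g s = \prod_(b in S) g b ^+ (b \in min S).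
  rewrite big_mkcond [RHS]big_mkcond; apply: eq_bigr => b _.
  by case: ifP => [/minimalsP[-> _]|]; [rewrite expr1|case: ifP].
rewrite -prodf_div; apply: eq_bigr => b bS.
by rewrite bottom_mobius_planar // expfzDr ?g0 // -exprnN.
Qed.

End Upset.
End PlanarCorners.

(** * Connected components *)

Section Components.
Variables (d : Order.disp_t) (T : finPOrderType d) (R : realType).
Variables (phi : bounded T -> R * R) (A : {set T}).
Hypotheses (planar : planar_embedding phi) (upA : upset A).

Local Notation min := (minimals <=%O A).
Local Notation left := (left_of phi).
Local Notation edge := (hasse_edge <=%O A).
Local Notation joinable p m := (isSome (join_opt <=%O A p m)).

Lemma hasse_connect_sym : connect_sym edge.
Proof. by apply: sym_connect_sym => x y; rewrite /hasse_edge orbC. Qed.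

Lemma hasse_edge_comparable a b : edge a b -> [/\ a \in A, b \in A & (a >=< b)%O].
Proof.
rewrite /hasse_edge /pcovers !plt_leE.
by case/orP => /and4P[aA bA /ltW ab _]; rewrite aA bA /Order.comparable ab ?orbT.
Qed.

Lemma connect_le a b : a \in A -> (a <= b)%O -> connect edge a b.
Proof.
have [n] := ubnP #|[set z | (a <= z)%O]|; elim: n a => // n IH a ltn aA.
rewrite le_eqVlt => /orP[/eqP ->|ab]; first exact: connect0.
have [c ac cb] := exists_ocover ab; have [ltac /forallP nac] := andP ac.
have cA := upA aA (ltW ltac).
apply: connect_trans (IH c _ cA cb); last first.
  move: ltn; rewrite ltnS; apply: leq_trans; apply: proper_card; apply/properP; split.
    by apply/subsetP => z; rewrite !inE; apply: le_trans (ltW ltac).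
  by exists a; rewrite !inE ?lexx // lt_geF.
apply: connect1; rewrite /hasse_edge /pcovers aA cA plt_leE ltac /=.
by apply/orP; left; apply/forall_inP => z _; rewrite !plt_leE.
Qed.

(* These turn out to be the leftmost minimal elements of the components. *)
Definition component_heads : {set T} :=
  [set s in min | [forall p, ((p, s) \in neighbors phi A) ==> ~~ joinable p s]].

Lemma mem_component_heads s : (s \in component_heads) =
  (s \in min) && [forall p, ((p, s) \in neighbors phi A) ==> ~~ joinable p s].
Proof. by rewrite in_set. Qed.

Lemma not_joinable (p m b : T) : p \in A -> ~~ joinable p m ->
  (p <= b)%O -> (m <= b)%O -> False.
Proof.
move=> pA nj pb mb; have [j E _] := join_opt_bounded planar upA pA pb mb.
by rewrite E in nj.
Qed.

(** Let p be the left neighbor of t. The set U of elements above p or above a minimal element left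
    of p contains s and not t, and no edge leaves it: otherwise some b would lie above minimal
    elements on both sides of the gap between p and t, hence above p and t, which have no join. *)
Lemma component_heads_disconnected s t : s \in component_heads -> t \in component_heads ->
  left s t -> ~~ connect edge s t.
Proof.
rewrite !mem_component_heads => /andP[sM _] /andP[tM /forallP tH] st.
have [p pt sp] := exists_predecessor (@left_of_irr _ _ _ phi) (@left_of_trans _ _ _ phi) sM tM st.
have npt : ~~ joinable p t by move: (tH p); rewrite pt.
have [pM _ ltpt Hpt] := neighborsP _ _ _ _ pt.
have [sA _] := minimalsP _ _ sM; have [tA tmin] := minimalsP _ _ tM.
have [pA _] := minimalsP _ _ pM.
have ltst : left s t := st.
pose U := [set b in A | [exists a in min, ((a == p) || left a p) && (a <= b)%O]].
have upU b c : b \in U -> (b <= c)%O -> c \in U.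
  rewrite !in_set => /andP[bA /exists_inP[a aM /andP[ap ab]]] bc.
  by rewrite (upA bA bc); apply/exists_inP; exists a; rewrite ?ap ?(le_trans ab).
have downU b c : b \in U -> c \in A -> (c <= b)%O -> c \in U.
  rewrite !in_set => /andP[bA /exists_inP[a aM /andP[ap ab]]] cA cb.
  rewrite cA; have [a' aM' ac] := exists_minimal cA.
  apply/exists_inP; exists a' => //; rewrite ac andbT; apply: contraT => npa.
  rewrite negb_or in npa; have [ne npa'] := andP npa.
  have pa' : left p a'.
    by have := minimals_left_total planar aM' pM ne; rewrite (negbTE npa').
  have a'b := le_trans ac cb.
  have pb : (p <= b)%O.
    case/orP: ap => [/eqP <- //|ap].
    exact: (minimals_below_interval planar aM pM aM' ap pa' ab a'b).
  have [Et|nt] := eqVneq a' t; first by subst a'; case: (not_joinable pA npt pb a'b).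
  have := minimals_left_total planar aM' tM nt => /orP[a't|ta']; first by case: (Hpt a').
  have tb := minimals_below_interval planar pM tM aM' ltpt ta' pb a'b.
  by case: (not_joinable pA npt pb tb).
have closedU : closed edge (mem U).
  move=> b c /hasse_edge_comparable[bA cA] /orP[bc|cb]; apply/idP/idP => h.
  - exact: upU h bc.
  - exact: downU h bA bc.
  - exact: downU h cA cb.
  - exact: upU h cb.
apply/negP => /(closed_connect closedU) E.
have sU : s \in U.
  rewrite in_set sA; apply/exists_inP; exists s => //; rewrite lexx andbT.
  by rewrite eq_sym.
move: sU; rewrite [s \in U]E in_set => /andP[_ /exists_inP[a aM /andP[ap a_t]]].
have aA : a \in A by case/minimalsP: aM.
have Ea := tmin a aA a_t; subst a.
have := ltpt; case/orP: ap => [/eqP <-|tp lpt]; first by rewrite left_of_irr.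
by have := left_of_trans tp lpt; rewrite left_of_irr.
Qed.

(** The leftmost minimal element of a component is a head: a join with its left neighbor would put
    that neighbor in the same component. *)
Lemma root_component_heads : [set fingraph.root edge s | s in component_heads] =
  [set r in A | roots edge r].
Proof.
have closedA : closed edge (mem A).
  by move=> b c /hasse_edge_comparable[bA cA _]; rewrite /= bA cA.
apply/setP => r; rewrite in_set; apply/imsetP/andP => [[s]|[rA rr]].
  rewrite mem_component_heads => /andP[/minimalsP[sA _] _] ->.
  rewrite roots_root ?hasse_connect_sym //; last exact: hasse_connect_sym.
  by rewrite -(closed_connect closedA (connect_root edge s)).
pose C := [set s in min | connect edge r s].
have CM : C \subset min by apply/subsetP => s; rewrite in_set => /andP[].
have C0 : C != set0.
  have [s sM sr] := exists_minimal rA; apply/set0Pn; exists s.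
  by rewrite in_set sM hasse_connect_sym connect_le //; case/minimalsP: sM.
have [l lC lmin] := exists_first (@left_of_irr _ _ _ phi) (@left_of_trans _ _ _ phi)
  (minimals_left_total planar (S := A)) CM C0.
have := lC; rewrite in_set => /andP[lM rl].
exists l; last first.
  by move/(fingraph.rootP hasse_connect_sym): rl => <-; rewrite (eqP rr).
rewrite mem_component_heads lM; apply/forallP => p; apply/implyP => pl; apply/negP.
case E : (join_opt _ _ _ _) => [j|] // _.
move/eqP: E; rewrite join_opt_some => /and4P[_ pj lj _].
have [pM _ ltpl _] := neighborsP _ _ _ _ pl.
have pA : p \in A by case/minimalsP: pM.
have lA : l \in A by case/minimalsP: lM.
have pC : p \in C.
  rewrite in_set pM (connect_trans rl) // (connect_trans (connect_le lA lj)) //.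
  by rewrite hasse_connect_sym connect_le.
have npl : p != l by apply: contraTneq ltpl => ->; rewrite left_of_irr.
by have := left_of_trans ltpl (lmin _ pC npl); rewrite left_of_irr.
Qed.

(** A minimal element is either a head, one per component, or has a join with its left neighbor, one
    per dull corner. *)
Lemma num_componentsE : (num_components <=%O A + size (neighbor_joins phi A A))%N = #|min|.
Proof.
have -> : num_components <=%O A = #|component_heads|.
  rewrite -(card_in_imset (f := fingraph.root edge)).
    rewrite root_component_heads /num_components /n_comp_mem.
    by apply: eq_card => r; rewrite !inE andbC.
  move=> s t sH tH /(fingraph.rootP hasse_connect_sym) st; apply/eqP; apply: contraT => ne.
  have := sH; have := tH; rewrite !mem_component_heads => /andP[tM _] /andP[sM _].
  case/orP: (minimals_left_total planar sM tM ne) => h.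
    by have := component_heads_disconnected sH tH h; rewrite st.
  by have := component_heads_disconnected tH sH h; rewrite hasse_connect_sym st.
pose J := [set s in neighbors phi A | joinable s.1 s.2].
have -> : size (neighbor_joins phi A A) = #|snd @: J|.
  rewrite card_in_imset; last first.
    apply: sub_in2 (consecutive_inj (minimals_left_total planar (S := A))) => s.
    by rewrite in_set => /andP[].
  rewrite size_pmap -sum1_count big_enum_cond -sum1_card; apply: eq_bigl => s.
  by rewrite [RHS]in_set.
rewrite -(cardsID component_heads min) (setIidPr _); last first.
  by apply/subsetP => s; rewrite mem_component_heads => /andP[].
congr (_ + _)%N; apply: eq_card => m; rewrite in_setD.
apply/imsetP/andP => [[[p m'] /= H ->]|[mH mM]].
  move: H; rewrite in_set => /andP[pm jm].
  have [_ mM _ _] := neighborsP _ _ _ _ pm; split => //.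
  rewrite mem_component_heads mM /=; apply/forallPn; exists p.
  by rewrite pm jm.
move: mH; rewrite mem_component_heads mM /= => /forallPn[p]; rewrite negb_imply negbK => /andP[pm jm].
by exists (p, m); rewrite // in_set pm.
Qed.

End Components.

(** * Linear extensions *)

Section ChainWeights.
Variables (T : finType) (x0 : T) (le : rel T) (l : seq T).
Hypotheses (uniq_l : uniq l) (mem_l : forall x, x \in l).
Hypothesis le_nth : forall i j, (i < size l)%N -> (j < size l)%N ->
  le (nth x0 l i) (nth x0 l j) = (i <= j)%N.

Lemma big_chain (V : Type) (idx : V) (op : Monoid.com_law idx) (P : pred T) (F : T -> V) :
  \big[op/idx]_(x in [set: T] | P x) F x =
  \big[op/idx]_(i < size l | P (nth x0 l i)) F (nth x0 l i).
Proof.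
rewrite -(big_mkord (fun i => P (nth x0 l i)) (fun i => F (nth x0 l i))) -(big_nth x0 P F).
rewrite -[LHS]big_enum_cond /=; apply: perm_big; apply: uniq_perm; rewrite ?enum_uniq //.
by move=> x; rewrite mem_enum inE mem_l.
Qed.

Lemma le_index a b : le a b = (index a l <= index b l)%N.
Proof.
by rewrite -{1}(nth_index x0 (mem_l a)) -{1}(nth_index x0 (mem_l b)) le_nth ?index_mem.
Qed.

Lemma plt_nth i j : (i < size l)%N -> (j < size l)%N ->
  plt le (nth x0 l i) (nth x0 l j) = (i < j)%N.
Proof. by move=> il jl; rewrite /plt nth_uniq // le_nth // ltn_neqAle. Qed.

Lemma mobius_chain i j : (i < size l)%N -> (j < size l)%N ->
  mobius le [set: T] (nth x0 l i) (nth x0 l j) = (i == j)%:R - (i.+1 == j)%:R.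
Proof.
have anti : antisymmetric le.
  move=> a b; rewrite !le_index -eqn_leq => /eqP E.
  by rewrite -(nth_index x0 (mem_l a)) E nth_index.
have tr : transitive le by move=> b a c; rewrite !le_index; apply: leq_trans.
have [n] := ubnP j; elim: n j => // n IH j ltn il jl.
rewrite mobiusE ?inE // nth_uniq // le_nth //.
case: (ltngtP i j) => [ij|ji|->]; last first.
- by rewrite gtn_eqF // subr0.
- by rewrite gtn_eqF ?subrr // (leq_trans ji).
have delta c (P : pred nat) : (c < size l)%N ->
    \sum_(m < size l | P m) (c == m)%:R = (P c)%:R :> int.
  move=> cl; rewrite big_mkcond (bigD1 (Ordinal cl)) //= eqxx big1 ?addr0 => [|m].
    by case: (P c).
  by rewrite -val_eqE /= eq_sym => /negbTE ->; case: ifP.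
rewrite big_chain (eq_big (fun m : 'I_(size l) => (i <= m < j)%N)
  (fun m : 'I_(size l) => (i == m)%:R - (i.+1 == m)%:R)) => [||m].
- rewrite sumrB !(delta _ (fun m => i <= m < j)%N) // ?(leq_ltn_trans ij jl) //.
  rewrite leqnn ij leqnSn /= sub0r; congr (- _).
  have -> : (i.+1 < j)%N = (i.+1 != j) by rewrite ltn_neqAle ij andbT.
  by case: eqP; rewrite ?subr0 ?subrr.
- by move=> m; rewrite le_nth // plt_nth.
- by rewrite le_nth // plt_nth // => /andP[_ mj]; apply: IH => //; apply: leq_trans mj _.
Qed.

Lemma prod_chain_mobius (F : fieldType) (w : T -> T -> F) :
  \prod_(a in [set: T]) \prod_(b in [set: T] | plt le a b) w a b ^ mobius le [set: T] a b =
  \prod_(0 <= i < (size l).-1) (w (nth x0 l i) (nth x0 l i.+1))^-1.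
Proof.
rewrite (eq_bigl (fun a => (a \in [set: T]) && true)) => [|a].
  2: by rewrite andbT.
rewrite big_chain.
rewrite (eq_bigr (fun i : 'I__ => if (i.+1 < size l)%N then
   (w (nth x0 l i) (nth x0 l i.+1))^-1 else 1)) => [|i _].
  rewrite -(big_mkord xpredT (fun i => if (i.+1 < size l)%N then
    (w (nth x0 l i) (nth x0 l i.+1))^-1 else 1)).
  case: (size l) => [|n]; first by rewrite !big_geq.
  rewrite big_nat_recr //= ltnn mulr1; apply: eq_big_nat => i /andP[_ lin].
  by rewrite ltnS lin.
rewrite big_chain; case: ifP => [il|/negbT il].
  rewrite (bigD1 (Ordinal il)) /= ?plt_nth // mobius_chain // ltn_eqF // eqxx.
  rewrite sub0r -exprN1 big1 ?mulr1 // => j /andP[]; rewrite plt_nth // => ij ne.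
  rewrite mobius_chain // ltn_eqF // (_ : (i.+1 == j) = false) ?subrr //.
  by apply: contraNF ne => /eqP E; apply/eqP/val_inj.
rewrite big1 // => j; rewrite plt_nth // => ij.
by rewrite (leq_ltn_trans ij) in il.
Qed.

End ChainWeights.

(** * Summation by the first elements of a linear extension *)

Section LinearExtensionSums.
Variables (d : Order.disp_t) (T : finPOrderType d) (u : T).
Implicit Types (L : {set T * T}) (p : seq T) (S : {set T}).

Local Notation LE := (linear_extensions T).
Local Notation min := (minimals <=%O).

Definition listing L : seq T := sort (rel_of L) (enum T).

Lemma linear_extensionP L : reflect
  [/\ forall a b, (a <= b)%O -> rel_of L a b, total (rel_of L),
      antisymmetric (rel_of L) & transitive (rel_of L)] (L \in LE).
Proof.
rewrite inE; apply: (iffP and4P) => -[H1 H2 H3 H4]; split.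
- by move=> a b ab; move/forallP/(_ a)/forallP/(_ b)/implyP: H1; apply.
- by move=> a b; move/forallP/(_ a)/forallP/(_ b): H2.
- by move=> a b ab; move/forallP/(_ a)/forallP/(_ b)/implyP/(_ ab)/eqP: H3.
- move=> b a c ab bc; move/forallP/(_ a)/forallP/(_ b)/forallP/(_ c)/implyP: H4.
  by apply; rewrite ab.
- by apply/forallP => a; apply/forallP => b; apply/implyP; apply: H1.
- by apply/forallP => a; apply/forallP => b; apply: H2.
- by apply/forallP => a; apply/forallP => b; apply/implyP => /H3 ->.
- apply/forallP => a; apply/forallP => b; apply/forallP => c.
  by apply/implyP => /andP[]; apply: H4.
Qed.

Lemma listing_uniq L : uniq (listing L).
Proof. by rewrite sort_uniq enum_uniq. Qed.

Lemma mem_listing L x : x \in listing L.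
Proof. by rewrite mem_sort mem_enum. Qed.

Lemma size_listing L : size (listing L) = #|T|.
Proof. by rewrite size_sort cardE. Qed.

Lemma rel_of_nth L i j : L \in LE -> (i < #|T|)%N -> (j < #|T|)%N ->
  rel_of L (nth u (listing L) i) (nth u (listing L) j) = (i <= j)%N.
Proof.
case/linear_extensionP => _ tot anti tr iT jT.
have sl : sorted (rel_of L) (listing L) by apply: sort_sorted.
have rfl : reflexive (rel_of L) by move=> x; have := tot x x; rewrite orbb.
have le_nth := sorted_leq_nth tr rfl u sl.
apply/idP/idP => [|ij]; last by apply: le_nth => //; rewrite inE size_listing.
apply: contraTT; rewrite -ltnNge => ji; apply/negP => Hij.
have Hji : rel_of L (nth u (listing L) j) (nth u (listing L) i).
  by apply: le_nth; rewrite ?inE ?size_listing // ltnW.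
have /eqP := anti _ _ (introT andP (conj Hij Hji)).
by rewrite nth_uniq ?listing_uniq ?size_listing // gtn_eqF.
Qed.

Lemma rel_of_index L a b : L \in LE ->
  rel_of L a b = (index a (listing L) <= index b (listing L))%N.
Proof.
move=> LL; apply: (@le_index _ u) => [x|i j]; first exact: mem_listing.
by rewrite size_listing; apply: rel_of_nth.
Qed.

(** An element outside p has index [size p], so the second condition also forces p to be closed
    downwards. *)
Definition linear_prefix p :=
  uniq p /\ forall a b, b \in p -> (a <= b)%O -> (index a p <= index b p)%N.

Lemma linear_prefix_listing p : linear_prefix p -> (forall x, x \in p) ->
  forall L, (L \in LE) && (listing L == p) = (L == [set s | (index s.1 p <= index s.2 p)%N]).
Proof.
move=> [Up Hp] Ap L; set Lp := [set s | _].
have LpE a b : rel_of Lp a b = (index a p <= index b p)%N by rewrite /rel_of inE.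
apply/andP/eqP => [[LL /eqP E]|->].
  apply/setP => -[a b]; rewrite [RHS]inE /= -E -rel_of_index //.
have LL : Lp \in LE.
  apply/linear_extensionP; split.
  - by move=> a b ab; rewrite LpE Hp.
  - by move=> a b; rewrite !LpE leq_total.
  - move=> a b; rewrite !LpE -eqn_leq => /eqP E.
    by rewrite -(nth_index u (Ap a)) E nth_index.
  - by move=> b a c; rewrite !LpE; apply: leq_trans.
split => //; apply/eqP.
have [_ tot anti tr] := linear_extensionP _ LL.
apply: (sorted_eq tr anti).
- exact: sort_sorted.
- rewrite sorted_pairwise //; apply/(pairwiseP u) => i j.
  rewrite !inE => ip jp ij; by rewrite LpE !index_uniq // ltnW.
- by apply: uniq_perm => //; [exact: listing_uniq|move=> x; rewrite mem_listing Ap].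
Qed.

Lemma linear_prefix_le p a b : linear_prefix p -> b \in p -> (a <= b)%O -> a \in p.
Proof.
by move=> [_ Hp] bp ab; rewrite -index_mem (leq_ltn_trans (Hp a b bp ab)) // index_mem.
Qed.

Lemma linear_prefix_rcons p s : linear_prefix p -> s \in min (~: [set x in p]) ->
  linear_prefix (rcons p s).
Proof.
move=> Hp /minimalsP[]; rewrite in_setC in_set => sp smin.
have [Up Hle] := Hp; split; first by rewrite rcons_uniq sp.
move=> a b; rewrite mem_rcons inE -cats1 !index_cat.
case: (boolP (b \in p)) => [bp _ ab|bp].
  by rewrite (linear_prefix_le Hp bp ab) Hle.
rewrite orbF => /eqP -> ab; case: (boolP (a \in p)) => ap.
  by rewrite (leq_trans (ltnW _) (leq_addr _ _)) // index_mem.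
by rewrite (smin a) // in_setC in_set.
Qed.

Variables (F : fieldType) (w : T -> T -> F).

(** S holds the elements still to be listed, a is the last one listed, and n is |S| in every use. *)
Fixpoint minimal_removal_sum n S (a : T) : F :=
  if n is n'.+1 then
    \sum_(s in min S) (w a s)^-1 * minimal_removal_sum n' (S :\ s) s
  else 1.

Lemma sum_listing_prefix p m : linear_prefix p -> size p = m.+1 ->
  \sum_(L in LE | take m.+1 (listing L) == p)
    \prod_(m <= i < #|T|.-1) (w (nth u (listing L) i) (nth u (listing L) i.+1))^-1
  = minimal_removal_sum #|~: [set x in p]| (~: [set x in p]) (last u p).
Proof.
move En : #|~: [set x in p]| => n.
elim: n m p En => [|n IH] m p En Hp sp.
  have [Up _] := Hp.
  have Ap x : x \in p.
    by move/eqP: En; rewrite cards_eq0 => /eqP/setP/(_ x); rewrite !inE => /negbFE.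
  have sT : size p = #|T|.
    rewrite -(card_uniqP Up); apply: eq_card => x; by rewrite Ap.
  rewrite (eq_bigl (pred1 [set s | (index s.1 p <= index s.2 p)%N])) => [|L].
    by rewrite big_pred1_eq big_geq // -sT sp.
  by rewrite /= -linear_prefix_listing // -sp sT -(size_listing L) take_size.
have [Up _] := Hp.
have szp : (m.+1 < #|T|)%N.
  have := cardsC [set x in p]; rewrite En cardsE (card_uniqP Up) sp => <-.
  by rewrite addnS ltnS leq_addr.
(* The element listed right after p is a minimal element of the complement of p; it determines the
   factor of index m. *)
rewrite /= (partition_big (fun L => nth u (listing L) m.+1) (mem (min (~: [set x in p])))) /=.
  apply: eq_bigr => s sM.
  have [] := minimalsP _ _ sM; rewrite in_setC in_set => sp' _.
  have ES : (~: [set x in p]) :\ s = ~: [set x in rcons p s].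
    by apply/setP => x; rewrite !inE mem_rcons inE negb_or.
  have En' : #|~: [set x in rcons p s]| = n.
    by move: En; rewrite -ES (cardsD1 s) in_setC in_set sp' => -[].
  have := IH m.+1 (rcons p s) En' (linear_prefix_rcons Hp sM).
  rewrite size_rcons sp => /(_ erefl); rewrite last_rcons ES => <-.
  rewrite big_distrr /=; apply: eq_big => [L|L /andP[/andP[LL /eqP tk] /eqP ns]].
    rewrite -andbA; congr (_ && _).
    by rewrite [in RHS](take_nth u) ?size_listing // eqseq_rcons.
  rewrite big_ltn ?ltn_predRL //.
  congr (_ * _); rewrite ns; congr (w _ _)^-1.
  by rewrite -tk (take_nth u) ?last_rcons ?size_listing ?(ltnW szp).
move=> L /andP[LL /eqP tk].
have idx : index (nth u (listing L) m.+1) (listing L) = m.+1.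
  by rewrite index_uniq ?size_listing ?listing_uniq.
have memp x : (x \in p) = (index x (listing L) < m.+1)%N.
  by rewrite -tk in_take ?mem_listing.
apply/minimalsP; split=> [|a]; rewrite in_setC in_set memp; first by rewrite idx ltnn.
move=> ap ale; have [ext _ _ _] := linear_extensionP _ LL.
have := ext _ _ ale; rewrite rel_of_index // idx => aidx.
have E : index a (listing L) = m.+1 by apply/eqP; rewrite eqn_leq aidx leqNgt.
by rewrite -E nth_index // mem_listing.
Qed.

Lemma sum_linear_extensions : (forall a, (u <= a)%O) ->
  \sum_(L in LE) \prod_(a in [set: T]) \prod_(b in [set: T] | plt (rel_of L) a b)
     w a b ^ mobius (rel_of L) [set: T] a b
  = minimal_removal_sum #|[set~ u]| [set~ u] u.
Proof.
move=> ubot.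
have H1 : linear_prefix [:: u].
  split=> // a b; rewrite inE => /eqP -> au.
  have -> : a = u by apply: le_anti; rewrite au ubot.
  by [].
have T0 : (0 < #|T|)%N by rewrite (cardD1 u) inE.
have := sum_listing_prefix H1 (erefl _).
have -> : ~: [set x in [:: u]] = [set~ u] by apply/setP => x; rewrite !inE.
move=> <-; apply: eq_big => [L|L LL].
  case: (boolP (L \in LE)) => //= LL; apply/esym/eqP.
  rewrite (take_nth u) ?size_listing // take0 /=; congr [:: _].
  have [ext _ _ _] := linear_extensionP _ LL.
  have := ext _ _ (ubot (nth u (listing L) 0)); rewrite rel_of_index //.
  rewrite index_uniq ?size_listing ?listing_uniq // leqn0 => /eqP E.
  by rewrite -E nth_index ?mem_listing.
rewrite (@prod_chain_mobius _ u _ (listing L)) ?listing_uniq ?size_listing //.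
- exact: mem_listing.
- by move=> i j iT jT; apply: rel_of_nth.
Qed.

End LinearExtensionSums.

(** * The closed form *)

Section ClosedForm.
Variables (d : Order.disp_t) (T : finPOrderType d) (R : realType).
Variables (phi : bounded T -> R * R) (A : {set T}).
Hypotheses (planar : planar_embedding phi) (upA : upset A).
Variables (F : fieldType) (x : T -> F) (x_inj : injective x).
Hypothesis x_neq0 : forall a, x a != 0.
Implicit Types (S : {set T}).

Local Notation mu := (mobius <=%O A).
Local Notation nu := (bottom_mobius A).
Local Notation min := (minimals <=%O).

(** The part of [Delta] left after writing each weight as (x_b - x_a) / (x_b c) and setting the
    denominators aside. *)
Definition mobius_product S : F :=
  \prod_(a in S) \prod_(b in S | plt <=%O a b) (x b - x a) ^ mu a b.

(* Up to sign, the residue at [z = x s] of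
   [\prod_(b in S) (x b - z) ^ bottom_mobius A S b]. *)
Definition corner_residue S (s : T) : F :=
  \prod_(b in S :\ s) (x b - x s) ^ nu S b.

Section Upset.
Variable S : {set T}.
Hypotheses (SA : S \subset A) (upS : upset S).

Lemma corner_residueE s : s \in min S ->
  corner_residue S s = \prod_(c <- neighbor_joins phi A S) (x c - x s)
    / \prod_(t in min S | t != s) (x t - x s).
Proof.
move=> sM; have [sS _] := minimalsP _ _ sM.
(* The factor of b = s, which vanishes, is replaced by 1 so that [prod_expz_bottom_mobius]
   applies. *)
pose g b := if b == s then 1 else x b - x s.
have g0 : {in S, forall b, g b != 0}.
  by move=> b _; rewrite /g; case: (eqVneq b s) => [_|ne]; rewrite ?oner_eq0 // subr_eq0 (inj_eq x_inj).
have := prod_expz_bottom_mobius planar SA upA upS g0.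
rewrite (big_setD1 s) //= {1}/g eqxx exp1rz mul1r => E.
rewrite /corner_residue; transitivity (\prod_(b in S :\ s) g b ^ nu S b).
  by apply: eq_bigr => b; rewrite !inE /g => /andP[/negbTE ->].
rewrite E; congr (_ / _).
  rewrite big_seq [RHS]big_seq; apply: eq_bigr => c cJ; rewrite /g; case: (eqVneq c s) => // Ec.
  by have := neighbor_join_gt cJ; rewrite Ec sM.
rewrite (bigD1 s) //= {1}/g eqxx mul1r; apply: eq_bigr => t /andP[_ /negbTE].
by rewrite /g => ->.
Qed.

Lemma bottom_mobius_partial_fractions z : S != set0 -> {in S, forall b, z != x b} ->
  \prod_(b in S) (x b - z) ^ nu S b =
  \sum_(s in min S) (x s - z)^-1 * corner_residue S s.
Proof.
move=> S0 zS.
have zS0 : {in S, forall b, x b - z != 0} by move=> b bS; rewrite subr_eq0 eq_sym zS.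
rewrite (prod_expz_bottom_mobius planar SA upA upS zS0).
pose l := [seq x s | s <- enum (min S)].
pose p : {poly F} := \prod_(c <- [seq x c | c <- neighbor_joins phi A S]) (c%:P - 'X).
have pE t : p.[t] = \prod_(c <- neighbor_joins phi A S) (x c - t).
  by rewrite horner_prod big_map; apply: eq_bigr => c _; rewrite !hornerE.
have Ul : uniq l by rewrite map_inj_uniq ?enum_uniq.
have szp : (size p <= size l)%N.
  rewrite (leq_trans (size_prod_subX _)) // !size_map -cardE.
  exact: size_neighbor_joins.
have zl : z \notin l.
  apply/mapP => -[s]; rewrite mem_enum => /minimalsP[sS _] E.
  by have := zS s sS; rewrite E eqxx.
have := lagrange_partial_fractions Ul szp zl; rewrite pE /l !big_map !big_enum /= => ->.
apply: eq_bigr => s sM; rewrite corner_residueE // pE big_map big_enum_cond /=.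
by congr (_ * (_ / _)); apply: eq_bigl => t; rewrite (inj_eq x_inj).
Qed.

(** Removing s takes from the Möbius product exactly the powers of exponent mu(s, b) by which nu_S
    differs from nu of [S :\ s]. Thus the residue of G_S at x_s becomes the value at x_s of the
    function of the smaller up-set. *)
Lemma mobius_product_setD1 s : s \in min S ->
  mobius_product (S :\ s) * \prod_(b in S :\ s) (x b - x s) ^ nu (S :\ s) b =
  mobius_product S * corner_residue S s.
Proof.
move=> sM; have [sS smin] := minimalsP _ _ sM; have sSA := subsetP SA.
rewrite /mobius_product [in RHS](big_setD1 s) //=.
have -> : \prod_(a in S :\ s) \prod_(b in S | plt <=%O a b) (x b - x a) ^ mu a b =
          \prod_(a in S :\ s) \prod_(b in S :\ s | plt <=%O a b) (x b - x a) ^ mu a b.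
  apply: eq_bigr => a; rewrite in_setD1 => /andP[ne aS]; apply: eq_bigl => b.
  rewrite in_setD1; case: (eqVneq b s) => // ->; rewrite plt_leE /= sS /=.
  by apply/negP => /ltW /(smin a aS) E; rewrite E eqxx in ne.
rewrite -mulrA [RHS]mulrCA; congr (_ * _).
have -> : \prod_(b in S | plt <=%O s b) (x b - x s) ^ mu s b =
          \prod_(b in S :\ s) (x b - x s) ^ mu s b.
  rewrite big_mkcondr [LHS](big_setD1 s) //= plt_leE ltxx mul1r.
  apply: eq_bigr => b; rewrite in_setD1 plt_leE => /andP[ne bS]; case: ifP => // /negbT nlt.
  by rewrite mobius_nle ?sSA // -?lt_neqAle; apply: contra nlt; rewrite lt_neqAle eq_sym ne.
rewrite /corner_residue -big_split /=; apply: eq_bigr => b; rewrite in_setD1 => /andP[ne bS].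
by rewrite bottom_mobius_setD1 // [nu S b + _]addrC expfzDr // subr_eq0 (inj_eq x_inj).
Qed.

End Upset.

Variables (c : F) (w : T -> T -> F).
Hypothesis wE : {in A &, forall a s, (w a s)^-1 = c * x s / (x s - x a)}.

Lemma minimal_removal_sumE S a : S \subset A -> upset S -> a \in A -> a \notin S ->
  minimal_removal_sum w #|S| S a =
  c ^+ #|S| * \prod_(b in S) x b * mobius_product S * \prod_(b in S) (x b - x a) ^ nu S b.
Proof.
move En : #|S| => n; elim: n S a En => [|n IH] S a En SA upS aA aS.
  have -> : S = set0 by apply/eqP; rewrite -cards_eq0 En.
  by rewrite /mobius_product !big_set0 /= expr0 !mulr1.
have S0 : S != set0 by rewrite -cards_eq0 En.
have xaS : {in S, forall b, x a != x b}.
  by move=> b bS; rewrite (inj_eq x_inj); apply: contraNneq aS => ->.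
rewrite (bottom_mobius_partial_fractions SA upS S0 xaS) /= mulr_sumr.
apply: eq_bigr => s sM; have [sS _] := minimalsP _ _ sM.
rewrite wE //; last exact: (subsetP SA).
rewrite IH.
- rewrite -(mulrA (_ * _) (mobius_product (S :\ s))) (mobius_product_setD1 SA sM).
  by rewrite (big_setD1 s sS) /= exprS; ring.
- by move: En; rewrite (cardsD1 s) sS => -[].
- exact: subset_trans (subsetDl _ _) SA.
- exact: upset_setD1.
- exact: (subsetP SA).
- by rewrite !inE eqxx.
Qed.

(** The term of s before its weight is applied, needed because the weights at u are not
    differences. *)
Lemma minimal_removal_sum_corner S s : S \subset A -> upset S -> s \in min S ->
  minimal_removal_sum w #|S|.-1 (S :\ s) s =
  c ^+ #|S|.-1 * (\prod_(b in S) x b / x s) * mobius_product S * corner_residue S s.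
Proof.
move=> SA upS sM; have [sS _] := minimalsP _ _ sM.
have E : #|S|.-1 = #|S :\ s| by rewrite (cardsD1 s S) sS.
rewrite E minimal_removal_sumE.
- rewrite -(mulrA (_ * _) (mobius_product (S :\ s))) (mobius_product_setD1 SA sM).
  rewrite [X in _ = _ * (X / _) * _ * _](big_setD1 s sS) /=.
  by have -> : x s * \prod_(b in S :\ s) x b / x s = \prod_(b in S :\ s) x b; [rewrite mulrC mulKf|rewrite mulrA].
- exact: subset_trans (subsetDl _ _) SA.
- exact: upset_setD1.
- exact: (subsetP SA).
- by rewrite !inE eqxx.
Qed.

Lemma minimal_removal_sum_root u k : A != set0 ->
  {in A, forall s, (w u s)^-1 = x s ^+ k} ->
  minimal_removal_sum w #|A| A u =
  c ^+ #|A|.-1 * \prod_(b in A) x b * mobius_product A *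
  \sum_(s in min A) x s ^+ k / x s * corner_residue A s.
Proof.
rewrite -card_gt0 => A0 wu; rewrite -{1}(prednK A0) /= mulr_sumr.
apply: eq_bigr => s sM; have [sA _] := minimalsP _ _ sM.
by rewrite wu // minimal_removal_sum_corner //; ring.
Qed.

(** The partial fraction expansion at z = 0, which is no pole as no x_b is zero. *)
Lemma sum_inv_corner_residue : A != set0 ->
  \sum_(s in min A) x s ^+ 0 / x s * corner_residue A s =
  (\prod_(b <- neighbor_joins phi A A) x b) / \prod_(s in min A) x s.
Proof.
move=> A0; rewrite -(prod_expz_bottom_mobius planar (subxx A) upA upA) //.
have := bottom_mobius_partial_fractions (subxx A) upA A0 (z := 0).
under eq_bigr do rewrite subr0.
move=> -> => [|b _]; last by rewrite eq_sym.
by apply: eq_bigr => s _; rewrite expr0 subr0 mul1r.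
Qed.

Lemma sum_power_corner_residue (k cc : nat) :
  #|min A| = (cc + size (neighbor_joins phi A A))%N -> (0 < cc)%N ->
  \sum_(s in min A) x s ^+ k.+1 / x s * corner_residue A s =
  (-1) ^+ (cc - 1) * \sum_(0 <= t < (size (neighbor_joins phi A A)).+1)
    (-1) ^+ t * elem_sym t [seq x b | b <- neighbor_joins phi A A]
    * hom_sym (k.+1%:Z - t%:Z - cc%:Z) [seq x s | s <- enum (min A)].
Proof.
move=> Ecc cc0.
have Ul : uniq [seq x s | s <- enum (min A)] by rewrite map_inj_uniq ?enum_uniq.
have := @sum_powers_partial_fractions _ [seq x b | b <- neighbor_joins phi A A] _ k cc Ul.
rewrite !size_map -cardE => /(_ Ecc cc0) <-.
rewrite big_map big_enum /=; apply: eq_bigr => s sM.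
rewrite (corner_residueE (subxx A)) // big_map big_map big_enum_cond /=.
rewrite exprSr mulfK //; congr (_ * (_ / _)).
by apply: eq_bigl => t; rewrite (inj_eq x_inj).
Qed.

Lemma prod_weights_mobius : c != 0 ->
  \prod_(a in A) \prod_(b in A | plt <=%O a b) ((1 - x a / x b) / c) ^ mu a b =
  mobius_product A * \prod_(b in A) x b * c ^+ #|A| *
  ((\prod_(b <- neighbor_joins phi A A) x b) * c ^+ size (neighbor_joins phi A A)) /
  ((\prod_(s in min A) x s) * c ^+ #|min A|).
Proof.
move=> c0; pose g b := x b * c.
have g0 b : g b != 0 by rewrite mulf_neq0.
have prod_g (l : seq T) (P : pred T) : \prod_(b <- l | P b) g b =
    (\prod_(b <- l | P b) x b) * c ^+ count P l.
  by rewrite big_split /= big_const_seq iter_mulr mulr1.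
transitivity (\prod_(a in A) \prod_(b in A | plt <=%O a b)
   ((x b - x a) ^ mu a b * g b ^ (- mu a b))).
  apply: eq_bigr => a _; apply: eq_bigr => b _.
  rewrite -exprz_inv -expfzMl; congr (_ ^ _); rewrite /g; field.
  by rewrite c0 x_neq0.
under eq_bigr do rewrite big_split.
rewrite big_split /= -/(mobius_product A) -!mulrA; congr (_ * _).
rewrite (exchange_big_dep (mem A)) /=; last by move=> a b _ /andP[].
(* The exponent of g b is minus the sum of mu(a, b) over a < b, that is nu(b) + 1, because mu(b, b)
   = 1. *)
transitivity (\prod_(b in A) (g b * g b ^ nu A b)).
  apply: eq_bigr => b bA; rewrite -{2}[g b]expr1z -expfzDr //.
  rewrite -(big_morph (fun n : int => g b ^ n) (fun m n => expfzDr m n (g0 b)) (expr0z _)).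
  congr (_ ^ _); rewrite sumrN.
  rewrite /bottom_mobius [X in 1 - X](bigD1 b) //= mobius_id // opprD addNKr.
  congr (- _); rewrite [RHS](bigID (fun a => plt <=%O a b)) /= [X in _ + X]big1 ?addr0.
    apply: eq_bigl => a; rewrite bA /plt; case: (a \in A); case: eqP; rewrite ?andbF //=.
  move=> a /andP[/andP[aA ne]]; rewrite /plt ne /= => nab.
  exact: mobius_nle.
rewrite big_split /= (prod_expz_bottom_mobius planar (subxx A) upA upA) //.
rewrite prod_g count_predT -[\prod_(s in A) g s]big_enum -[\prod_(s in min A) g s]big_enum.
rewrite !prod_g !count_predT -!cardE !big_enum /= !invfM; ring.
Qed.

End ClosedForm.

(** * The field of rational functions *)

Section RationalFunctionField.
Variables (K : fieldType) (d : Order.disp_t) (T : finPOrderType d).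

Lemma mpolyX_inj (n : nat) : injective (fun i : 'I_n => 'X_i : {mpoly K[n]}).
Proof.
move=> i j /(congr1 (fun p => p@_U_(i)%MM)); rewrite !mcoeffX eqxx.
case: (eqVneq U_(j)%MM U_(i)%MM) => [/mnmP/(_ j)|_ /eqP]; last by rewrite oner_eq0.
by rewrite !mnm1E eqxx; case: eqP.
Qed.

Lemma xvar_inj : injective (xvar K : T -> _).
Proof.
by move=> a b /eqP; rewrite tofrac_eq => /eqP/mpolyX_inj/lift_inj/enum_rank_inj.
Qed.

Lemma mpolyXU_neq0 (n : nat) (i : 'I_n) : 'X_i != 0 :> {mpoly K[n]}.
Proof.
apply/eqP => /(congr1 (fun p => p@_U_(i)%MM)); rewrite mcoeffX eqxx mcoeff0.
by apply/eqP; rewrite oner_eq0.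
Qed.

Lemma xvar_neq0 (a : T) : xvar K a != 0.
Proof. by rewrite tofrac_eq0 mpolyXU_neq0. Qed.

Lemma qvar_sub_inv_neq0 : qvar K T - (qvar K T)^-1 != 0.
Proof.
have q0 : qvar K T != 0 by rewrite tofrac_eq0 mpolyXU_neq0.
rewrite subr_eq0; apply/eqP => /(congr1 ( *%R (qvar K T))); rewrite divff //.
rewrite -tofracM -tofrac1 => /eqP; rewrite tofrac_eq => /eqP.
move=> /(congr1 (fun p => p@_0%MM)); rewrite mcoeff1 eqxx -mpolyXD mcoeffX.
case: eqP => [/mnmP/(_ ord0)|_ /esym/eqP]; last by rewrite oner_eq0.
by rewrite mnmDE mnm1E mnm0E eqxx.
Qed.

End RationalFunctionField.

Lemma minimals_setT_bottom (d : Order.disp_t) (T : finPOrderType d) (u : T) :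
  minimals <=%O [set: T] = [set u] -> forall a, (u <= a)%O.
Proof.
move=> Hu a; have [s] := exists_minimal (in_setT a).
by rewrite Hu in_set1 => /eqP ->.
Qed.

(** * Both identities over an arbitrary field *)

Section WeightSums.
Variables (d : Order.disp_t) (T : finPOrderType d) (R : realType) (u : T).
Variables (phi : bounded T -> R * R) (F : fieldType) (x : T -> F) (c : F).
Hypotheses (planar : planar_embedding phi) (ubot : forall a, (u <= a)%O).
Hypotheses (x_inj : injective x) (x0 : forall a, x a != 0) (c0 : c != 0).

Let P : {set T} := [set~ u].
Hypothesis P0 : P != set0.

Let weight (k : nat) (a b : T) : F :=
  if a == u then x b ^- k else (1 - x a * (x b)^-1) / c.

Let weight_product (k : nat) (le : rel T) (A : {set T}) : F :=
  \prod_(a in A) \prod_(b in A | plt le a b) weight k a b ^ mobius le A a b.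

Let SC := minimals <=%O P.
Let DC := neighbor_joins phi P P.
Let cc := num_components <=%O P.

Lemma sum_weight_products :
  \sum_(L in linear_extensions T) weight_product 0 (rel_of L) [set: T]
    = c ^+ (cc - 1) * weight_product 0 <=%O P
  /\ forall k, \sum_(L in linear_extensions T) weight_product k.+1 (rel_of L) [set: T]
    = weight_product k.+1 <=%O P * (- c) ^+ (cc - 1)
       * (\prod_(s in SC) x s) * (\prod_(b <- DC) (x b)^-1)
       * \sum_(0 <= t < (size DC).+1)
           (-1) ^+ t * elem_sym t [seq x b | b <- DC]
           * hom_sym (k.+1%:Z - t%:Z - cc%:Z) [seq x s | s <- enum SC].
Proof.
have inP a : (a \in P) = (a != u) by rewrite in_setC in_set1.
have upP : upset P.
  move=> a b; rewrite !inP => au ab; apply: contraNneq au => E.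
  by rewrite E in ab; apply/eqP/le_anti; rewrite ab ubot.
have wtE k a s : a \in P -> weight k a s = (1 - x a / x s) / c.
  by rewrite inP /weight => /negbTE ->.
have wE k : {in P &, forall a s, (weight k a s)^-1 = c * x s / (x s - x a)}.
  move=> a s aP sP; rewrite wtE // invf_div.
  (* For a = s both sides are 0, the inverse of 0 being 0. *)
  have [->|ne] := eqVneq a s; first by rewrite divff // !subrr !invr0 !mulr0.
  have xsa : x s - x a != 0 by rewrite subr_eq0 (inj_eq x_inj) eq_sym.
  rewrite -[1](divff (x0 s)) -mulrBl invf_div; by field.
have wu k : {in P, forall s, (weight k u s)^-1 = x s ^+ k}.
  by move=> s sP; rewrite /weight eqxx invrK.
have DE k : weight_product k <=%O P = mobius_product P x P * \prod_(b in P) x b * c ^+ #|P| *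
  ((\prod_(b <- DC) x b) * c ^+ size DC) / ((\prod_(s in SC) x s) * c ^+ #|SC|).
  rewrite -(prod_weights_mobius planar upP x0 c0); apply: eq_bigr => a aP.
  by apply: eq_bigr => b bP; rewrite wtE.
have sumE k : \sum_(L in linear_extensions T) weight_product k (rel_of L) [set: T] =
    c ^+ #|P|.-1 * \prod_(b in P) x b * mobius_product P x P *
    \sum_(s in SC) x s ^+ k / x s * corner_residue P x P s.
  rewrite -(minimal_removal_sum_root planar upP x_inj x0 (wE k) P0 (wu k)).
  exact: sum_linear_extensions.
have Ecc : #|SC| = (cc + size DC)%N by rewrite -(num_componentsE planar upP).
have cc0 : (0 < cc)%N.
  have := size_neighbor_joins P planar P0; rewrite -/SC -/DC Ecc.
  by rewrite -{1}[size _]add0n ltn_add2r.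
have cP0 : (0 < #|P|)%N by rewrite card_gt0.
have XS : \prod_(s in SC) x s != 0 by apply/prodf_neq0.
have XD : \prod_(b <- DC) x b != 0 by rewrite prodf_seq_neq0; apply/allP => b _ /=.
(* The balance of the powers of c, from |SC| = cc + |DC|. *)
have Ec : c ^+ (cc - 1) * (c ^+ #|P| * c ^+ size DC / c ^+ #|SC|) = c ^+ #|P|.-1.
  rewrite Ecc exprD -{1}(prednK cP0) -{2}(prednK cc0) subn1 !exprS.
  by field; rewrite c0 !expf_neq0.
split=> [|k].
  rewrite sumE (sum_inv_corner_residue planar upP x_inj x0 P0) DE -Ec -/SC -/DC.
  by rewrite !invfM; ring.
rewrite sumE (sum_power_corner_residue planar upP x_inj x0 k Ecc cc0) DE -Ec -/SC -/DC.
rewrite [(- c) ^+ _]exprNn prodfV; set Sg := \sum_(0 <= t < _) _.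
move: XS XD (expf_neq0 #|SC| c0).
move: (\prod_(s in SC) x s) (\prod_(b <- DC) x b) (c ^+ #|SC|) => XS XD CS XS0 XD0 CS0.
by field; rewrite XS0 XD0 CS0.
Qed.

End WeightSums.

Theorem theorem4p6 (K : fieldType) (R : realType) (r : nat)
    (d : Order.disp_t) (T : finPOrderType d) (u : T)
    (phi : bounded T -> R * R) :
  (0 < r)%N ->
  minimals <=%O [set: T] = [set u] ->
  deleted u != set0 ->
  planar_embedding phi ->
  let P := deleted u in
  let q := qvar K T in
  let x := xvar K : T -> ratfun K T in
  let SC := sharp_corners u in
  let DC := dull_corners u phi in
  let cc := num_components <=%O P in
  (\sum_(L in linear_extensions T) Delta K u 0 (rel_of L) [set: T]
     = (q - q^-1) ^+ (cc - 1) * Delta K u 0 <=%O P)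
  /\
  (forall k : nat, (1 <= k <= r - 1)%N ->
   \sum_(L in linear_extensions T) Delta K u k (rel_of L) [set: T]
     = Delta K u k <=%O P * (- q + q^-1) ^+ (cc - 1)
       * (\prod_(s in SC) x s) * (\prod_(c <- DC) (x c)^-1)
       * \sum_(0 <= t < (size DC).+1)
           (-1) ^+ t * elem_sym t [seq x c | c <- DC]
           * hom_sym (k%:Z - t%:Z - cc%:Z) [seq x s | s <- enum SC]).
Proof.
move=> _ Hu P0 planar P q x SC DC cc.
(* With c = q - q^-1 the abstract weights, corners and joins unfold to [wt], [sharp_corners] and
   [dull_corners], so both parts follow by conversion. *)
have [sum0 sumS] := sum_weight_products planar (minimals_setT_bottom Hu)
  (@xvar_inj K d T) (@xvar_neq0 K d T) (@qvar_sub_inv_neq0 K d T) P0.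
split=> [|[|k] // _]; first exact: sum0.
have -> : - q + q^-1 = - (q - q^-1) by rewrite opprB addrC.
exact: sumS.
Qed.
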